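(* Let $P=(J,M)$ be a perfect Jordan-Kantor pair over $k$, let $L=\mathrm{TKK}(P)$, and endow $\mathfrak{uce}(L)$ with the canonical $\mathbb Z$-grading obtained from the $\mathbb Z$-grading of $L$. Then there is a Lie algebra isomorphism $\mathfrak{uce}(L)_0\to \mathfrak{uider}(P)$ given by $\langle a,b\rangle\mapsto a\diamond b$ and $\langle x,y\rangle\mapsto x\diamond y$ for $(a,b)\in J=(J^+,J^-)$, $(x,y)\in M=(M^+,M^-)$. In particular, for the canonical map $u:\mathfrak{uce}(L)\to L$ one has $(\ker u)_0\cong \mathrm{HC}(P)$.
   Context: Let $k$ be a commutative associative unital ring; $\sigma\in\{+,-\}$. Jordan-Kantor pair: $P=(J,M)$ with $J=(J^+,J^-)$, $M=(M^+,M^-)$ pairs of $k$-modules, together with quadratic maps $Q^\sigma:J^\sigma\to\mathrm{Hom}_k(J^{-\sigma},J^\sigma)$, bilinear maps $J^\sigma\times M^{-\sigma}\to M^\sigma$, $(a,y)\mapsto a\circ y$, bilinear maps $V^\sigma:M^\sigma\times M^{-\sigma}\to\mathrm{End}_k(M^\sigma)$ (write $\{x,y,z\}=V_{x,y}z$) and bilinear maps $\kappa:M^\sigma\times M^\sigma\to J^\sigma$ such that: (1) $J$ is a Jordan pair: with $Q_{a,c}=Q_{a+c}-Q_a-Q_c$ and $\{a,b,c\}=D_{a,b}c=Q_{a,c}b$, the identities $D_{a,b}Q_a=Q_aD_{b,a}$, $D_{Q_ab,b}=D_{a,Q_ba}$, $Q_{Q_ab}=Q_aQ_bQ_a$ hold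 in all scalar extensions; (2) $\{a,b,c\}\circ y=a\circ(b\circ(c\circ y))+c\circ(b\circ(a\circ y))$; (3) $[V_{x,y},V_{z,w}]=V_{V_{x,y}z,w}-V_{z,V_{y,x}w}$; (4) $\kappa(x,x)=0$; (5) $\kappa(x,z)\circ y=\{x,y,z\}-\{z,y,x\}$; $\kappa(x,z)\circ(b\circ u)=\{z,b\circ x,u\}-\{x,b\circ z,u\}$; $\kappa(b\circ x,y)\circ z=b\circ\{x,y,z\}+\{y,x,b\circ z\}$; $\{\kappa(x,z),b,a\}=\kappa(a\circ(b\circ x),z)+\kappa(x,a\circ(b\circ z))$; $\{a,\kappa(y,w),c\}=\kappa(a\circ w,c\circ y)+\kappa(c\circ w,a\circ y)$; $\kappa(\kappa(z,u)\circ y,x)=\kappa(\{x,y,z\},u)+\kappa(z,\{x,y,u\})$; for all $a,c\in J^\sigma$, $b\in J^{-\sigma}$, $x,u,z\in M^\sigma$, $y,w\in M^{-\sigma}$. $P$ is perfect if for $\sigma=\pm$: $J^\sigma=\{J^\sigma,J^{-\sigma},J^\sigma\}+\kappa(M^\sigma,M^\sigma)$ and $M^\sigma=\{M^\sigma,M^{-\sigma},M^\sigma\}+J^\sigma\circ M^{-\sigma}$ (spans). Also write $P$ for the $k$-module $J^-\oplus M^-\oplus M^+\oplus J^+$, graded by $P^{\pm2}=J^\pm$, $P^{\pm1}=M^\pm$. For $(a,b)\in J^+\times J^-$, $(x,y)\in M^+\times M^-$ define degree-preserving endomorphisms of $P$: $\delta(a,b)$ acts as $D_{a,b}$ on $J^+$,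 $-D_{b,a}$ on $J^-$, $z\mapsto a\circ(b\circ z)$ on $M^+$, $w\mapsto-b\circ(a\circ w)$ on $M^-$; $v(x,y)$ acts as $V_{x,y}$ on $M^+$, $-V_{y,x}$ on $M^-$, $c\mapsto\kappa(c\circ y,x)$ on $J^+$, $d\mapsto-\kappa(d\circ x,y)$ on $J^-$. $\mathfrak{ider}(P)$ is the span of all $\delta(a,b)$, $v(x,y)$, a Lie algebra under the commutator. $\mathrm{TKK}(P)=P\oplus\mathfrak{ider}(P)$ with $\mathfrak{ider}(P)$ in degree $0$ and bracket: the commutator on $\mathfrak{ider}(P)$; $[T,p]=T.p=-[p,T]$ for $T\in\mathfrak{ider}(P)$, $p\in P$; for $(a,x),(c,u)\in J^+\oplus M^+$ and $(b,y),(d,w)\in J^-\oplus M^-$: $[(a,x),(b,y)]=a\circ y+\delta(a,b)+v(x,y)-b\circ x=-[(b,y),(a,x)]$, $[(a,x),(c,u)]=\kappa(x,u)\in J^+$, $[(b,y),(d,w)]=\kappa(y,w)\in J^-$. It is a $\mathbb Z$-graded Lie algebra with support in $\{-2,\dots,2\}$. $\mathfrak{uider}(P)=\big((J^+\otimes J^-)\oplus(M^+\otimes M^-)\big)/I(P)$, where $I(P)$ is spanned by: $x\otimes\{y,x,y\}-\{x,y,x\}\otimes y$; $\{x,y,u\}\otimes w+\{u,w,x\}\otimes y-u\otimes\{y,x,w\}-x\otimes\{w,u,y\}$; $a\otimes\{b,a,b\}-\{a,b,a\}\otimes b$; $\{a,b,c\}\otimes d-c\otimes\{b,a,d\}+\{c,d,a\}\otimes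 b-a\otimes\{b,c,d\}$; $\kappa(u,x)\otimes b-x\otimes(b\circ u)+u\otimes(b\circ x)$; $a\otimes\kappa(y,w)-(a\circ y)\otimes w+(a\circ w)\otimes y$, for $a,c\in J^+$, $b,d\in J^-$, $x,u\in M^+$, $y,w\in M^-$. Cosets are written $a\diamond b$, $x\diamond y$. $\mathfrak{ider}(P)$ acts by $T.(p\diamond q)=T.p\diamond q+p\diamond T.q$; the linear map $\mathfrak{ud}:\mathfrak{uider}(P)\to\mathfrak{ider}(P)$, $a\diamond b\mapsto\delta(a,b)$, $x\diamond y\mapsto v(x,y)$, is well defined, and $\mathfrak{uider}(P)$ is a Lie algebra with $[p,q]=\mathfrak{ud}(p).q$. $\mathrm{HC}(P)=\ker\mathfrak{ud}$. For a Lie algebra $L$: $\mathfrak{uce}(L)=(L\wedge L)/\mathcal B$, $\mathcal B$ spanned by $x\wedge[y,z]+y\wedge[z,x]+z\wedge[x,y]$; $\langle x,y\rangle$ is the class of $x\wedge y$; $u(\langle x,y\rangle)=[x,y]$; the bracket is $[X,Y]=\langle u(X),u(Y)\rangle$. If $L$ is $\Gamma$-graded, then $\mathfrak{uce}(L)_\gamma=\sum_\delta\langle L_\delta,L_{\gamma-\delta}\rangle$. *)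

(* Defs.v *)
(* MathComp, with the classical layer of MathComp-Analysis. *)
From HB Require Import structures.
From mathcomp Require Import all_boot all_order all_algebra.
From mathcomp Require Import all_classical.

Set Implicit Arguments.
Unset Strict Implicit.
Unset Printing Implicit Defensive.

Import GRing.Theory.
Local Open Scope ring_scope.
Local Open Scope quotient_scope.

(** * Spans, submodules and quotient modules *)

Section Span.
Variables (k : pzRingType) (V : lmodType k).

Inductive span (S : set V) : set V :=
| span_gen v of S v : span S v
| span_zero : span S 0
| span_lin c u v of span S u & span S v : span S (c *: u + v).

Definition span_pred (S : set V) : {pred V} := fun v => `[< span S v >].

Lemma span_pred_closed S : submod_closed (span_pred S).
Proof.
split=> [|c u v]; first by apply/asboolP; exact: span_zero.
by move=> /asboolP Su /asboolP Sv; apply/asboolP; exact: span_lin.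
Qed.

HB.instance Definition _ S :=
  GRing.isSubmodClosed.Build k V (span_pred S) (span_pred_closed S).

Record submod (S : set V) := Submod {
  submod_val :> V;
  submodP : submod_val \in span_pred S }.

HB.instance Definition _ S := [isSub for @submod_val S].
HB.instance Definition _ S := [Choice of submod S by <:].
HB.instance Definition _ S := [SubChoice_isSubLmodule of submod S by <:].

Definition to_submod (S : set V) (v : V) (Sv : S v) : submod S :=
  Submod (asboolT (span_gen Sv)).

Definition qmod (S : set V) := Quotient.quot (span_pred S).

HB.instance Definition _ S := GRing.Zmodule.on (qmod S).

Definition qpi (S : set V) (v : V) : qmod S := \pi_(Quotient.quot (span_pred S)) v.

Definition qmod_scale S c (x : qmod S) : qmod S :=
  qpi S (c *: repr (x : Quotient.quot (span_pred S))).

Lemma qpi_eq S u v : (qpi S u = qpi S v) <-> span S (u - v).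
Proof.
split=> [/eqP|Suv].
  by rewrite -Quotient.idealrBE => /asboolP.
by apply/eqP; rewrite -Quotient.idealrBE; apply/asboolP.
Qed.

Lemma qmod_scaleE S c v : qmod_scale c (qpi S v) = qpi S (c *: v).
Proof.
apply/qpi_eq; rewrite -scalerBr -[_ *: _]addr0.
by apply: span_lin; [apply/qpi_eq; exact: reprK | exact: span_zero].
Qed.

Lemma qpi_repr S (x : qmod S) :
  qpi S (repr (x : Quotient.quot (span_pred S))) = x.
Proof. exact: reprK. Qed.

Lemma qpiD S u v : qpi S (u + v) = qpi S u + qpi S v.
Proof. exact: (raddfD \pi_(Quotient.quot (span_pred S))). Qed.

Lemma qmod_scaleA S a b (x : qmod S) :
  qmod_scale a (qmod_scale b x) = qmod_scale (a * b) x.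
Proof. by rewrite -[x]qpi_repr !qmod_scaleE scalerA. Qed.

Lemma qmod_scale1 S : left_id 1 (@qmod_scale S).
Proof. by move=> x; rewrite -[x]qpi_repr !qmod_scaleE scale1r. Qed.

Lemma qmod_scaleDr S : right_distributive (@qmod_scale S) +%R.
Proof.
move=> c x y; rewrite -[x]qpi_repr -[y]qpi_repr -qpiD !qmod_scaleE.
by rewrite scalerDr qpiD.
Qed.

Lemma qmod_scaleDl S x : {morph (@qmod_scale S)^~ x : a b / a + b}.
Proof. by move=> a b; rewrite -[x]qpi_repr !qmod_scaleE scalerDl qpiD. Qed.

HB.instance Definition _ S := GRing.Zmodule_isLmodule.Build k (qmod S)
  (@qmod_scaleA S) (@qmod_scale1 S) (@qmod_scaleDr S) (@qmod_scaleDl S).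

Lemma qpi_linear S : linear (qpi S).
Proof. by move=> c u v; rewrite qpiD -qmod_scaleE. Qed.

HB.instance Definition _ S := GRing.isLinear.Build k V (qmod S) _ (qpi S)
  (qpi_linear S).

(* The map induced on the quotient by [g]; it is computed on representatives,
   and is the expected one when [g] is linear and kills [S] ([qliftE]). *)
Definition qlift S (W : Type) (g : V -> W) (x : qmod S) : W :=
  g (repr (x : Quotient.quot (span_pred S))).

Lemma qliftE S (W : lmodType k) (g : {linear V -> W}) :
  (forall v, S v -> g v = 0) -> forall v, qlift g (qpi S v) = g v.
Proof.
move=> gS v; apply/eqP; rewrite -subr_eq0 -linearB; apply/eqP.
have: span S (repr (qpi S v : Quotient.quot (span_pred S)) - v).
  exact/qpi_eq/qpi_repr.
elim=> [u /gS//||c u w _ gu _ gw]; first exact: linear0.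
by rewrite linearP gu gw scaler0 addr0.
Qed.

Lemma qlift_linear S (W : lmodType k) (g : {linear V -> W}) :
  (forall v, S v -> g v = 0) -> linear (@qlift S W g).
Proof.
move=> gS c x y; rewrite -[x]qpi_repr -[y]qpi_repr -linearP !qliftE //.
exact: linearP.
Qed.

End Span.

Arguments to_submod {k V S v} Sv.
Arguments qpi {k V S} v.

(** * Free modules and tensor products *)

Section Free.
Variables (k : pzRingType) (T : choiceType).

Definition indic (t : T) : T -> k^o := fun t' => (t' == t)%:R.

(* Finitely supported functions, as the span of the indicators of points. *)
Definition free := submod [set f : T -> k^o | exists t, f = indic t].

HB.instance Definition _ := GRing.Lmodule.on free.

Definition fgen (t : T) : free := to_submod (ex_intro _ t erefl).

Definition flift (W : lmodType k) (g : T -> W) (f : free) : W :=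
  \sum_(t \in [set: T]) ((submod_val f) t : k) *: g t.

Lemma free_ind (Q : free -> Prop) : Q 0 ->
  (forall c x y, Q x -> Q y -> Q (c *: x + y)) -> (forall t, Q (fgen t)) ->
  forall f, Q f.
Proof.
move=> Q0 QP Qg f.
suff H g : span [set f : T -> k^o | exists t, f = indic t] g ->
    forall x : free, \val x = g -> Q x.
  by case: f => f Sf; exact: (H f (asboolW Sf)).
elim=> [{}g [t ->]||c u v Su IHu Sv IHv] x xg.
- by rewrite (_ : x = fgen t) //; exact: val_inj.
- by rewrite (_ : x = 0) //; exact: val_inj.
- pose u' : free := Submod (asboolT Su); pose v' : free := Submod (asboolT Sv).
  have -> : x = c *: u' + v' by apply: val_inj.
  by apply: QP; [exact: IHu | exact: IHv].
Qed.

Lemma free_supp (f : free) :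
  exists r : seq T, forall t, t \notin r -> submod_val f t = 0.
Proof.
elim/free_ind: f => [|c x y [r xr] [s ys]|t]; first by exists [::].
- exists (r ++ s) => t; rewrite mem_cat negb_or => /andP[/xr xt /ys yt].
  rewrite (_ : submod_val _ t = c *: submod_val x t + submod_val y t) //.
  by rewrite xt yt scaler0 addr0.
- by exists [:: t] => t'; rewrite inE /= /indic => /negPf->.
Qed.

Lemma fliftE_supp (W : lmodType k) (g : T -> W) (f : free) (r : seq T) :
  uniq r -> (forall t, t \notin r -> submod_val f t = 0) ->
  flift g f = \sum_(t <- r) (submod_val f t : k) *: g t.
Proof.
move=> ur fr; rewrite /flift (fsbigE r) //; last by move=> t _ /fr->; rewrite scale0r.
by apply: eq_bigl => t; rewrite in_setT.
Qed.

Lemma flift_linear (W : lmodType k) (g : T -> W) : linear (flift g).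
Proof.
move=> c x y; have [r xr] := free_supp x; have [s ys] := free_supp y.
set q := undup (r ++ s).
have qP t : t \notin q -> submod_val x t = 0 /\ submod_val y t = 0.
  by rewrite mem_undup mem_cat negb_or => /andP[/xr ? /ys ?].
rewrite !(@fliftE_supp _ _ _ q) ?undup_uniq //.
- rewrite scaler_sumr -big_split; apply: eq_bigr => t _ /=.
  by rewrite scalerA -scalerDl.
- by move=> t /qP[].
- by move=> t /qP[].
- move=> t /qP[xt yt].
  rewrite (_ : submod_val _ t = c *: submod_val x t + submod_val y t) //.
  by rewrite xt yt scaler0 addr0.
Qed.

HB.instance Definition _ (W : lmodType k) (g : T -> W) :=
  GRing.isLinear.Build k free W _ (flift g) (flift_linear g).

Lemma flift_gen (W : lmodType k) (g : T -> W) t : flift g (fgen t) = g t.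
Proof.
rewrite (@fliftE_supp _ _ _ [:: t]) // => [|t']; last first.
  by rewrite inE /= /indic => /negPf->.
by rewrite big_seq1 /= /indic eqxx scale1r.
Qed.

End Free.

Arguments fgen {k T} t.

Definition bilin (k : pzRingType) (A B C : lmodType k) (f : A -> B -> C) :=
  (forall a, linear (f a)) /\ (forall b, linear (f^~ b)).

Section Tensor.
Variables (k : pzRingType) (A B : lmodType k).

Variant tensor_rel : set (free k (A * B)%type) :=
| tensor_rel_l c a a' b :
    tensor_rel (fgen (c *: a + a', b) - (c *: fgen (a, b) + fgen (a', b)))
| tensor_rel_r c a b b' :
    tensor_rel (fgen (a, c *: b + b') - (c *: fgen (a, b) + fgen (a, b'))).

Definition tensor := qmod tensor_rel.

HB.instance Definition _ := GRing.Lmodule.on tensor.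

Definition pure (a : A) (b : B) : tensor := qpi (fgen (a, b)).

(* The linear map with [a ⊗ b |-> f a b], for [f] bilinear ([tlift_pure]). *)
Definition tlift (C : lmodType k) (f : A -> B -> C) : tensor -> C :=
  qlift (flift (fun p => f p.1 p.2)).

Lemma pure_bilin : bilin pure.
Proof.
split=> [a c b b'|b c a a'].
all: rewrite /pure -linearP; apply/qpi_eq/span_gen.
- exact: tensor_rel_r.
- exact: tensor_rel_l.
Qed.

Lemma tensor_ind (Q : tensor -> Prop) : Q 0 ->
  (forall c x y, Q x -> Q y -> Q (c *: x + y)) -> (forall a b, Q (pure a b)) ->
  forall t, Q t.
Proof.
move=> Q0 QP Qp t; rewrite -[t]qpi_repr; elim/free_ind: (repr _).
- by rewrite linear0.
- by move=> c x y Qx Qy; rewrite linearP; exact: QP.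
- by case=> a b; exact: Qp.
Qed.

Section Lift.
Variables (C : lmodType k) (f : A -> B -> C) (f_bilin : bilin f).

Let kills v : tensor_rel v -> flift (fun p : A * B => f p.1 p.2) v = 0.
Proof.
by case=> [c a a' b|c a b b']; rewrite linearB linearP /= !flift_gen /=;
  rewrite ?f_bilin.1 ?f_bilin.2 subrr.
Qed.

Lemma tlift_pure a b : tlift f (pure a b) = f a b.
Proof. by rewrite /tlift qliftE //= flift_gen. Qed.

Lemma tlift_linear : linear (tlift f).
Proof. exact: qlift_linear. Qed.

End Lift.
End Tensor.

Arguments pure {k A B} a b.

(** * Scalar extensions *)

Section ScalarExtension.
Variables (k : comPzRingType) (K : comAlgType k) (A : lmodType k).

Definition scalext := tensor (K : lmodType k) A.

HB.instance Definition _ := GRing.Zmodule.on scalext.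

Definition scalext_scale (c : K) : scalext -> scalext :=
  tlift (fun (d : K) (a : A) => pure (c * d) a).

Let scale_bilin (c : K) :
  bilin (fun (d : K) (a : A) => pure (c * d) a : tensor (K : lmodType k) A).
Proof.
split=> [d|a] e u v; first by rewrite (pure_bilin _ _).1.
by rewrite mulrDr -scalerAr (pure_bilin _ _).2.
Qed.

Let scale_lin c := tlift_linear (scale_bilin c).

HB.instance Definition _ c :=
  GRing.isLinear.Build k (tensor (K : lmodType k) A)
    (tensor (K : lmodType k) A) _ (scalext_scale c) (scale_lin c).

Lemma scalext_scale_pure c d a :
  scalext_scale c (pure d a) = pure (c * d) a.
Proof. exact/tlift_pure/scale_bilin. Qed.

Lemma scalext_scaleA c d t :
  scalext_scale c (scalext_scale d t) = scalext_scale (c * d) t.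
Proof.
elim/tensor_ind: t => [|e x y Hx Hy|e a]; first by rewrite !linear0.
  by rewrite !linearP /= Hx Hy.
by rewrite !scalext_scale_pure mulrA.
Qed.

Lemma scalext_scale1 : left_id 1 scalext_scale.
Proof.
elim/tensor_ind=> [|e x y Hx Hy|e a]; first by rewrite linear0.
  by rewrite linearP /= Hx Hy.
by rewrite scalext_scale_pure mul1r.
Qed.

Lemma scalext_scaleDr : right_distributive scalext_scale +%R.
Proof. by move=> c x y; exact: (linearD (scalext_scale c)). Qed.

Lemma scalext_scaleDl t : {morph scalext_scale^~ t : c d / c + d}.
Proof.
move=> c d; elim/tensor_ind: t => [|e x y Hx Hy|e a].
- by rewrite !linear0 addr0.
- by rewrite !linearP /= Hx Hy scalerDr addrACA.
- rewrite !scalext_scale_pure mulrDl -[c * e]scale1r.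
  by rewrite (pure_bilin _ _).2 !scale1r.
Qed.

HB.instance Definition _ := GRing.Zmodule_isLmodule.Build K scalext
  scalext_scaleA scalext_scale1 scalext_scaleDr scalext_scaleDl.

Definition ext_in (a : A) : scalext := pure (1 : K) a.

End ScalarExtension.

Arguments ext_in {k} K {A} a.

(** * Jordan pairs and Jordan-Kantor pairs *)

Section JordanPair.
Variable k : comPzRingType.

Definition polar (U V : lmodType k) (q : U -> V) (u v : U) : V :=
  q (u + v) - q u - q v.

Definition quadratic (U V : lmodType k) (q : U -> V) :=
  (forall c u, q (c *: u) = c ^+ 2 *: q u) /\ bilin (polar q).

Section Half.
Variables (A B : lmodType k) (QA : A -> B -> A) (QB : B -> A -> B).

(* [QA] as a quadratic map from A to Hom(B, A) *)
Definition hom_quadratic :=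
  (forall a, linear (QA a)) /\ (forall b, quadratic (QA^~ b)).

(* {a, b, c} = D_{a,b} c = Q_{a,c} b *)
Definition jtriple (a : A) (b : B) (c : A) : A := polar (QA^~ b) a c.

End Half.

Record jordan_identities (A B : lmodType k)
    (QA : A -> B -> A) (QB : B -> A -> B) : Prop := JordanIdentities {
  jp1 : forall a b d,
    jtriple QA a b (QA a d) = QA a (jtriple QB b a d);
  jp2 : forall a b c,
    jtriple QA (QA a b) b c = jtriple QA a (QB b a) c;
  jp3 : forall a b d,
    QA (QA a b) d = QA a (QB b (QA a d)) }.

End JordanPair.

(* A pair of quadratic maps over k extends uniquely to a pair of quadratic maps
   over K; [jordan_ext] asks the identities of that extension. *)
Record jordan_pair (k : comPzRingType) (Jp Jm : lmodType k)
    (Qp : Jp -> Jm -> Jp) (Qm : Jm -> Jp -> Jm) : Prop := JordanPair {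
  jordan_quadp : hom_quadratic Qp;
  jordan_quadm : hom_quadratic Qm;
  jordan_ext : forall K : comAlgType k,
    exists (QKp : scalext K Jp -> scalext K Jm -> scalext K Jp)
           (QKm : scalext K Jm -> scalext K Jp -> scalext K Jm),
    [/\ hom_quadratic QKp /\ hom_quadratic QKm,
        (forall a b, QKp (ext_in K a) (ext_in K b) = ext_in K (Qp a b)),
        (forall b a, QKm (ext_in K b) (ext_in K a) = ext_in K (Qm b a)),
        jordan_identities QKp QKm & jordan_identities QKm QKp] }.

(* The remaining axioms for one sign: J, M are the components of that sign and
   J', M' those of the opposite sign. *)
Record jk_axioms (k : comPzRingType) (J J' M M' : lmodType k)
    (Q : J -> J' -> J)
    (act : J -> M' -> M) (act' : J' -> M -> M')
    (V : M -> M' -> M -> M) (V' : M' -> M -> M' -> M')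
    (kap : M -> M -> J) (kap' : M' -> M' -> J') : Prop := JKAxioms {
  jk_act_bilin : bilin act;
  jk_V_linear : forall x y, linear (V x y);
  jk_V_bilin : forall z, bilin (fun x y => V x y z);
  jk_kap_bilin : bilin kap;
  jk_act_triple : forall a b c y,
    act (jtriple Q a b c) y =
      act a (act' b (act c y)) + act c (act' b (act a y));
  jk_V_comm : forall x y z w u,
    V x y (V z w u) - V z w (V x y u) = V (V x y z) w u - V z (V' y x w) u;
  jk_kap_alt : forall x, kap x x = 0;
  jk_kap_act : forall x z y,
    act (kap x z) y = V x y z - V z y x;
  jk_kap_act_act : forall x z b u,
    act (kap x z) (act' b u) = V z (act' b x) u - V x (act' b z) u;
  jk_act_kap_act : forall b x y z,
    act' (kap' (act' b x) y) z = act' b (V x y z) + V' y x (act' b z);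
  jk_kap_triple : forall x z b a,
    jtriple Q (kap x z) b a =
      kap (act a (act' b x)) z + kap x (act a (act' b z));
  jk_triple_kap : forall a y w c,
    jtriple Q a (kap' y w) c =
      kap (act a w) (act c y) + kap (act c w) (act a y);
  jk_kap_kap : forall z u y x,
    kap (act (kap z u) y) x = kap (V x y z) u + kap z (V x y u) }.

Record jkPair (k : comPzRingType) := JKPair {
  Jp : lmodType k; Jm : lmodType k;
  Mp : lmodType k; Mm : lmodType k;
  Qp : Jp -> Jm -> Jp;         Qm : Jm -> Jp -> Jm;
  actp : Jp -> Mm -> Mp;       actm : Jm -> Mp -> Mm;
  Vp : Mp -> Mm -> Mp -> Mp;   Vm : Mm -> Mp -> Mm -> Mm;
  kapp : Mp -> Mp -> Jp;       kapm : Mm -> Mm -> Jm;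
  jk_jordan : jordan_pair Qp Qm;
  jk_p : jk_axioms Qp actp actm Vp Vm kapp kapm;
  jk_m : jk_axioms Qm actm actp Vm Vp kapm kapp }.

Section JKPair.
Variables (k : comPzRingType) (P : jkPair k).

Definition Dp (a : Jp P) (b : Jm P) (c : Jp P) : Jp P := jtriple (@Qp k P) a b c.
Definition Dm (b : Jm P) (a : Jp P) (d : Jm P) : Jm P := jtriple (@Qm k P) b a d.

Definition jk_perfect : Prop :=
  [/\ forall e : Jp P, span [set e | (exists a b c, e = Dp a b c) \/
                                     (exists x z, e = kapp x z)] e,
      forall e : Jm P, span [set e | (exists a b c, e = Dm a b c) \/
                                     (exists x z, e = kapm x z)] e,
      forall u : Mp P, span [set u | (exists x y z, u = Vp x y z) \/
                                     (exists a y, u = actp a y)] u &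
      forall u : Mm P, span [set u | (exists x y z, u = Vm x y z) \/
                                     (exists a y, u = actm a y)] u].

(* J^- ⊕ M^- ⊕ M^+ ⊕ J^+ *)
Definition jk_mod := (Jm P * Mm P * Mp P * Jp P)%type.

HB.instance Definition _ := GRing.Lmodule.on jk_mod.

Definition mkP (d : Jm P) (w : Mm P) (z : Mp P) (c : Jp P) : jk_mod := (d, w, z, c).
Definition toJm (p : jk_mod) : Jm P := p.1.1.1.
Definition toMm (p : jk_mod) : Mm P := p.1.1.2.
Definition toMp (p : jk_mod) : Mp P := p.1.2.
Definition toJp (p : jk_mod) : Jp P := p.2.
Definition inJm (b : Jm P) : jk_mod := mkP b 0 0 0.
Definition inMm (y : Mm P) : jk_mod := mkP 0 y 0 0.
Definition inMp (x : Mp P) : jk_mod := mkP 0 0 x 0.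
Definition inJp (a : Jp P) : jk_mod := mkP 0 0 0 a.

Definition delta (a : Jp P) (b : Jm P) : jk_mod -> jk_mod := fun p =>
  mkP (- Dm b a (toJm p)) (- actm b (actp a (toMm p)))
      (actp a (actm b (toMp p))) (Dp a b (toJp p)).

Definition vee (x : Mp P) (y : Mm P) : jk_mod -> jk_mod := fun p =>
  mkP (- kapm (actm (toJm p) x) y) (- Vm y x (toMm p))
      (Vp x y (toMp p)) (kapp (actp (toJp p) y) x).

Definition ider_gen : set (jk_mod -> jk_mod) :=
  [set T | (exists a b, T = delta a b) \/ (exists x y, T = vee x y)].

Definition ider := submod ider_gen.

HB.instance Definition _ := GRing.Lmodule.on ider.

Definition ider_delta a b : ider := @to_submod _ _ ider_gen (delta a b)
  (or_introl (ex_intro _ a (ex_intro _ b erefl))).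

Definition ider_vee x y : ider := @to_submod _ _ ider_gen (vee x y)
  (or_intror (ex_intro _ x (ex_intro _ y erefl))).

End JKPair.

(** * Lie algebras *)

Section Lie.
Variable k : comPzRingType.

Record is_lie (L : lmodType k) (br : L -> L -> L) : Prop := IsLie {
  lie_bilin : bilin br;
  lie_alt : forall x, br x x = 0;
  lie_jacobi : forall x y z,
    br x (br y z) + br y (br z x) + br z (br x y) = 0 }.

Record is_lie_iso (L L' : lmodType k) (br : L -> L -> L)
    (br' : L' -> L' -> L') (phi : L -> L') : Prop := IsLieIso {
  lie_iso_source : is_lie br;
  lie_iso_target : is_lie br';
  lie_iso_linear : linear phi;
  lie_iso_bij : bijective phi;
  lie_iso_bracket : {morph phi : x y / br x y >-> br' x y} }.

Definition span_closed (V : lmodType k) (S : set V) (br : V -> V -> V) : Prop :=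
  forall u v, span S u -> span S v -> span S (br u v).

(* The restriction of [br] to the span of [S]; the default value 0 is never
   taken when that span is closed under [br]. *)
Definition sub_bracket (V : lmodType k) (S : set V) (br : V -> V -> V)
  (u v : submod S) : submod S := insubd 0 (br (submod_val u) (submod_val v)).

End Lie.

(** * The universal central extension *)

Section Uce.
Variables (k : comPzRingType) (L : lmodType k) (br : L -> L -> L).

Definition exterior2 := qmod [set t : tensor L L | exists x, t = pure x x].

HB.instance Definition _ := GRing.Lmodule.on exterior2.

Definition wedge (x y : L) : exterior2 := qpi (pure x y).

Definition uce := qmod [set w : exterior2 | exists x y z,
  w = wedge x (br y z) + wedge y (br z x) + wedge z (br x y)].

HB.instance Definition _ := GRing.Lmodule.on uce.

Definition ang (x y : L) : uce := qpi (wedge x y).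

Definition uce_u : uce -> L := qlift (qlift (tlift br)).

Lemma uce_u_ang : is_lie br -> forall x y, uce_u (ang x y) = br x y.
Proof.
move=> brL; pose f := HB.pack (tlift br)
  (GRing.isLinear.Build k _ _ _ _ (tlift_linear (lie_bilin brL))) :
  {linear tensor L L -> L}.
have fE x y : f (pure x y) = br x y := tlift_pure (lie_bilin brL) x y.
have f0 t : (exists x, t = pure x x) -> f t = 0.
  by case=> x ->; rewrite fE lie_alt.
pose g := HB.pack (qlift f : exterior2 -> L)
  (GRing.isLinear.Build k _ _ _ _ (qlift_linear f0)) :
  {linear exterior2 -> L}.
have gE x y : g (wedge x y) = br x y by rewrite -fE; exact: (qliftE f0).
move=> x y; rewrite -gE; apply: (qliftE (g := g)) => w [a [b [c ->]]].
by rewrite !linearD !gE lie_jacobi.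
Qed.

Definition uce_bracket (X Y : uce) : uce := ang (uce_u X) (uce_u Y).

Definition uce_gen (G : int -> set L) (g : int) : set uce :=
  [set X | exists (d : int) (x y : L), [/\ G d x, G (g - d) y & X = ang x y]].

Definition uce_deg (G : int -> set L) (g : int) := submod (uce_gen G g).

HB.instance Definition _ G g := GRing.Lmodule.on (uce_deg G g).

Definition uce_deg_bracket G : uce_deg G 0 -> uce_deg G 0 -> uce_deg G 0 :=
  @sub_bracket k uce (uce_gen G 0) uce_bracket.

End Uce.

Arguments uce_gen {k L} br G g.
Arguments uce_deg {k L} br G g.
Arguments uce_deg_bracket {k L} br G X Y : rename.
Arguments uce_bracket {k L} br X Y.
Arguments ang {k L} br x y.

(** * The Tits-Kantor-Koecher algebra and [uider] *)

Section TKK.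
Variables (k : comPzRingType) (P : jkPair k).

Definition commutator (T S : jk_mod P -> jk_mod P) : jk_mod P -> jk_mod P :=
  fun p => T (S p) - S (T p).

Definition ider_bracket : ider P -> ider P -> ider P :=
  @sub_bracket k (jk_mod P -> jk_mod P) (@ider_gen k P) commutator.

Definition ider_app (T : ider P) (p : jk_mod P) : jk_mod P := submod_val T p.

Definition tkk := (jk_mod P * ider P)%type.

HB.instance Definition _ := GRing.Lmodule.on tkk.

Definition tkk_bracket (l l' : tkk) : tkk :=
  let: (p, T) := l in let: (q, U) := l' in
  (ider_app T q - ider_app U p +
     mkP (kapm (toMm p) (toMm q))
         (actm (toJm p) (toMp q) - actm (toJm q) (toMp p))
         (actp (toJp p) (toMm q) - actp (toJp q) (toMm p))
         (kapp (toMp p) (toMp q)),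
   ider_bracket T U
     + (ider_delta (toJp p) (toJm q) + ider_vee (toMp p) (toMm q))
     - (ider_delta (toJp q) (toJm p) + ider_vee (toMp q) (toMm p))).

Definition tkk_deg (g : int) : set tkk := [set l |
  [/\ g != - 2 -> toJm l.1 = 0, g != - 1 -> toMm l.1 = 0, g != 0 -> l.2 = 0,
      g != 1 -> toMp l.1 = 0 & g != 2 -> toJp l.1 = 0]].

Definition tkk_in (p : jk_mod P) : tkk := (p, 0).

Definition uce0 := uce_deg tkk_bracket tkk_deg 0.

HB.instance Definition _ := GRing.Lmodule.on uce0.

Definition uce0_bracket : uce0 -> uce0 -> uce0 := uce_deg_bracket tkk_bracket tkk_deg.

Lemma uce0_J_subproof (a : Jp P) (b : Jm P) :
  uce_gen tkk_bracket tkk_deg 0 (ang tkk_bracket (tkk_in (inJp a)) (tkk_in (inJm b))).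
Proof. by exists 2, (tkk_in (inJp a)), (tkk_in (inJm b)). Qed.

Lemma uce0_M_subproof (x : Mp P) (y : Mm P) :
  uce_gen tkk_bracket tkk_deg 0 (ang tkk_bracket (tkk_in (inMp x)) (tkk_in (inMm y))).
Proof. by exists 1, (tkk_in (inMp x)), (tkk_in (inMm y)). Qed.

(* ⟨a, b⟩ and ⟨x, y⟩ *)
Definition uce0_J a b : uce0 := to_submod (uce0_J_subproof a b).
Definition uce0_M x y : uce0 := to_submod (uce0_M_subproof x y).

Definition uce0_u (X : uce0) : tkk := uce_u (submod_val X).

Definition uider_pre := (tensor (Jp P) (Jm P) * tensor (Mp P) (Mm P))%type.

HB.instance Definition _ := GRing.Lmodule.on uider_pre.

Definition preJ (a : Jp P) (b : Jm P) : uider_pre := (pure a b, 0).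
Definition preM (x : Mp P) (y : Mm P) : uider_pre := (0, pure x y).

Variant uider_rel : set uider_pre :=
| uider_rel1 x y :
    uider_rel (preM x (Vm y x y) - preM (Vp x y x) y)
| uider_rel2 x y u w :
    uider_rel (preM (Vp x y u) w + preM (Vp u w x) y
               - preM u (Vm y x w) - preM x (Vm w u y))
| uider_rel3 a b :
    uider_rel (preJ a (Dm b a b) - preJ (Dp a b a) b)
| uider_rel4 a b c d :
    uider_rel (preJ (Dp a b c) d - preJ c (Dm b a d)
               + preJ (Dp c d a) b - preJ a (Dm b c d))
| uider_rel5 u x b :
    uider_rel (preJ (kapp u x) b - preM x (actm b u) + preM u (actm b x))
| uider_rel6 a y w :
    uider_rel (preJ a (kapm y w) - preM (actp a y) w + preM (actp a w) y).

Definition uider := qmod uider_rel.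

HB.instance Definition _ := GRing.Lmodule.on uider.

Definition diaJ (a : Jp P) (b : Jm P) : uider := qpi (preJ a b).
Definition diaM (x : Mp P) (y : Mm P) : uider := qpi (preM x y).

Definition uider_lift (W : lmodType k) (f : Jp P -> Jm P -> W)
    (g : Mp P -> Mm P -> W) : uider -> W :=
  qlift (fun t => tlift f t.1 + tlift g t.2).

Definition ud : uider -> ider P := uider_lift (@ider_delta k P) (@ider_vee k P).

(* T.(p ◇ q) = T.p ◇ q + p ◇ T.q *)
Definition uider_act (T : ider P) : uider -> uider :=
  uider_lift
    (fun a b => diaJ (toJp (ider_app T (inJp a))) b +
                diaJ a (toJm (ider_app T (inJm b))))
    (fun x y => diaM (toMp (ider_app T (inMp x))) y +
                diaM x (toMm (ider_app T (inMm y)))).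

Definition uider_bracket (p q : uider) : uider := uider_act (ud p) q.

Definition HC : set uider := [set p | ud p = 0].

End TKK.

Arguments tkk_bracket {k} P l l'.
Arguments tkk_deg {k} P g.
Arguments uce0_bracket {k} P X Y : rename.
Arguments uider_bracket {k} P p q.
Arguments HC {k} P.

(* Main.v *)
(* Degree 0 of uce(TKK(P)) is spanned by the <a, b>, <x, y> and <T, U>. The
   cocycle identity applied to U = [p, q] gives <T, U> = <T.p, q> + <p, T.q>, so
   the first two kinds suffice; applied to T = U, and to [u, x] = kappa(u,
     x), it
   gives the defining relations of uider(P). Hence there is a surjection psi
     from
   uider(P) onto that part. Conversely ider(P) acts on uider(P) by derivations,
   and TKK(P) has the central extension P + uider(P), whose bracket, read off on
   lifts and projected to uider(P), is a 2-cocycle; the linear map it induces on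
   uce(TKK(P)) is a left inverse of psi. *)
From HB Require Import structures.
Require Import Defs.
From mathcomp Require Import all_boot all_order all_algebra.
From mathcomp Require Import all_classical.

Set Implicit Arguments.
Unset Strict Implicit.
Unset Printing Implicit Defensive.

Import GRing.Theory.
Local Open Scope classical_set_scope.
Local Open Scope ring_scope.

(** * Identities in abelian groups, by reflection *)

(** Over a general ring [ud] need not have a linear section, so the cocycle is not built as the
    defect of one. Elements of uider(P) act in the extension only through [ud]; hence the kernel of
    the projection onto TKK(P) is central, the bracket of two lifts depends only on the elements
    lifted, and it is bilinear for an arbitrary choice of lifts. Since 2 need not be invertible,
    alternation and skew-symmetry are separate demands: the first and third relations of uider(P)
    give [p, p] = 0 on generators, the second and fourth give skew-symmetry for generators of the
    same kind, and the two relations with kappa are the Jacobi identity in degrees (1, 1, -2) and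
    (2, -1, -1). Everything rests on ider(P) acting by derivations of all the products. For the
    triple product of J this is the five-linear Jordan identity, which has to be extracted from the
    quadratic axioms. *)

Inductive zexp := ZVar of nat | ZZero | ZAdd of zexp & zexp | ZOpp of zexp.

Fixpoint zeval (V : zmodType) (env : seq V) (e : zexp) : V :=
  match e with
  | ZVar i => env`_i
  | ZZero => 0
  | ZAdd e1 e2 => zeval env e1 + zeval env e2
  | ZOpp e1 => - zeval env e1
  end.

Fixpoint zcoef (e : zexp) (i : nat) : int :=
  match e with
  | ZVar j => (i == j)%:Z
  | ZZero => 0
  | ZAdd e1 e2 => zcoef e1 i + zcoef e2 i
  | ZOpp e1 => - zcoef e1 i
  end.

Fixpoint zbounded (n : nat) (e : zexp) : bool :=
  match e with
  | ZVar i => (i < n)%N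
  | ZZero => true
  | ZAdd e1 e2 => zbounded n e1 && zbounded n e2
  | ZOpp e1 => zbounded n e1
  end.

Lemma zevalE (V : zmodType) (env : seq V) e : zbounded (size env) e ->
  zeval env e = \sum_(i < size env) env`_i *~ zcoef e i.
Proof.
elim: e => [j jn||e1 IH1 e2 IH2 /andP[b1 b2]|e IH b] /=.
- rewrite (bigD1 (Ordinal jn)) //= eqxx mulr1z big1 ?addr0 // => i.
  by rewrite -val_eqE /= => /negPf->.
- by rewrite big1.
- by rewrite IH1 ?IH2 // -big_split; apply: eq_bigr => i _ /=; rewrite mulrzDr.
- by rewrite IH // -sumrN; apply: eq_bigr => i _; rewrite mulrNz.
Qed.

Definition zcheck (n : nat) (e1 e2 : zexp) : bool :=
  [&& zbounded n e1, zbounded n e2 &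
      all (fun i => zcoef e1 i == zcoef e2 i) (iota 0 n)].

Lemma zcheckP (V : zmodType) (env : seq V) e1 e2 :
  zcheck (size env) e1 e2 -> zeval env e1 = zeval env e2.
Proof.
case/and3P=> b1 b2 /allP e12; rewrite !zevalE //; apply: eq_bigr => i _.
by rewrite (eqP (e12 i _)) // mem_iota add0n ltn_ord.
Qed.

Ltac zindex x env :=
  lazymatch env with
  | x :: _ => constr:(0%N)
  | _ :: ?env' => let i := zindex x env' in constr:(S i)
  end.

(** The inner [match goal] is a conditional: its second branch runs when [zindex] fails, that is,
    when [t] is a new atom. *)
Ltac zatoms t env :=
  lazymatch t with
  | (?a + ?b)%R => let env' := zatoms a env in zatoms b env'
  | (- ?a)%R => zatoms a env
  | 0%R => env
  | _ =>
    match goal with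
    | _ => let i := zindex t env in env
    | _ => constr:(t :: env)
    end
  end.

Ltac zquote t env :=
  lazymatch t with
  | (?a + ?b)%R =>
    let a' := zquote a env in let b' := zquote b env in constr:(ZAdd a' b')
  | (- ?a)%R => let a' := zquote a env in constr:(ZOpp a')
  | 0%R => constr:(ZZero)
  | _ => let i := zindex t env in constr:(ZVar i)
  end.

Ltac zmod :=
  cbv beta;
  lazymatch goal with
  | |- @eq ?T ?l ?r =>
    let env0 := zatoms l (@nil T) in
    let env := zatoms r env0 in
    let l' := zquote l env in
    let r' := zquote r env in
    apply: (@zcheckP _ env l' r'); vm_compute; reflexivity
  end.

(** * Linear and bilinear maps *)

Section LinearMaps.
Variables (k : pzRingType) (A B : lmodType k).

(** Lifts such as [tlift f] are bare functions, linear only under hypotheses on [f]; packing them on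
    demand makes the lemmas about [{linear A -> B}] applicable. *)
Lemma lin_ext (g : A -> B) : linear g -> exists h : {linear A -> B}, g = h.
Proof.
by move=> gl; exists (HB.pack g (GRing.isLinear.Build k _ _ _ g gl) : {linear
  A -> B}).
Qed.

Lemma lin0 (g : A -> B) : linear g -> g 0 = 0.
Proof. by move=> /lin_ext[h ->]; exact: linear0. Qed.

Lemma linD (g : A -> B) : linear g -> {morph g : x y / x + y}.
Proof. by move=> /lin_ext[h ->]; exact: linearD. Qed.

Lemma linN (g : A -> B) : linear g -> {morph g : x / - x}.
Proof. by move=> /lin_ext[h ->]; exact: linearN. Qed.

End LinearMaps.

Lemma lin_comp (k : pzRingType) (A B C : lmodType k) (h : B -> C) (g : A -> B) :
  linear h -> linear g -> linear (h \o g).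
Proof. by move=> hl gl c x y /=; rewrite gl hl. Qed.

Section BilinearMaps.
Variables (k : pzRingType) (A B C : lmodType k).
Variables (f : A -> B -> C) (fb : bilin f).

Lemma bilDl a a' b : f (a + a') b = f a b + f a' b.
Proof. exact: (linD (fb.2 b)). Qed.
Lemma bilDr a b b' : f a (b + b') = f a b + f a b'.
Proof. exact: (linD (fb.1 a)). Qed.
Lemma bilNl a b : f (- a) b = - f a b.
Proof. exact: (linN (fb.2 b)). Qed.
Lemma bilNr a b : f a (- b) = - f a b.
Proof. exact: (linN (fb.1 a)). Qed.
Lemma bil0l b : f 0 b = 0.
Proof. exact: (lin0 (fb.2 b)). Qed.
Lemma bil0r a : f a 0 = 0.
Proof. exact: (lin0 (fb.1 a)). Qed.

Definition bilE := (bilDl, bilDr, bilNl, bilNr, bil0l, bil0r).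

End BilinearMaps.

Lemma bil_altC (k : pzRingType) (A B : lmodType k) (f : A -> A -> B) :
  bilin f -> (forall x, f x x = 0) -> forall x y, f x y = - f y x.
Proof.
move=> fb alt x y; apply/eqP; rewrite -addr_eq0; apply/eqP.
by have := alt (x + y); rewrite !(bilE fb) !alt add0r addr0.
Qed.

Lemma submod_ind (k : pzRingType) (V : lmodType k) (S : set V)
    (Q : submod S -> Prop) : Q 0 ->
  (forall c x y, Q x -> Q y -> Q (c *: x + y)) ->
  (forall v (Sv : S v), Q (to_submod Sv)) -> forall x, Q x.
Proof.
move=> Q0 QP Qg.
suff H v : Defs.span S v -> forall x : submod S, \val x = v -> Q x.
  by case=> v Sv; exact: (H v (asboolW Sv)).
elim=> [{}v Sv||c u {}v Su IHu Sv IHv] x xv.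
- by rewrite (_ : x = to_submod Sv) //; exact: val_inj.
- by rewrite (_ : x = 0) //; exact: val_inj.
- pose u' : submod S := Submod (asboolT Su).
  pose v' : submod S := Submod (asboolT Sv).
  rewrite (_ : x = c *: u' + v'); last exact: val_inj.
  by apply: QP; [exact: IHu | exact: IHv].
Qed.

(** * The five-linear identity of Jordan pairs *)

(** The scalar extension K = k is realized by the regular algebra [R^o] of a [comNzRingType]; the
    zero ring is treated apart. *)
Lemma comNz_of_oner_neq0 (k : comPzRingType) :
  (1 : k) != 0 -> exists R : comNzRingType, k = R.
Proof.
case: k => s c n1; pose k : comPzRingType := GRing.ComPzRing.Pack c.
pose R : comNzRingType := HB.pack s k (GRing.PzSemiRing_isNonZero.Build k n1).
by exists R; rewrite /R; case: c @k n1 R.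
Qed.

(** Take K = k: multiplication, d ⊗ a |-> d a, is a left inverse of [ext_in]. *)
Lemma ext_in_cancel (k : comPzRingType) : (1 : k) != 0 ->
  exists K : comAlgType k, forall A : lmodType k, injective (@ext_in k K A).
Proof.
move=> /comNz_of_oner_neq0[R ->]; exists R^o => A.
have scb : bilin (fun (d : R^o) (a : A) => (d : R) *: a).
  split=> [d|a] c u v; first by rewrite scalerDr !scalerA mulrC.
  by rewrite scalerDl -scalerA.
apply: (can_inj (g := tlift (fun (d : R^o) (a : A) => (d : R) *: a))) => a.
by rewrite /ext_in (tlift_pure scb) scale1r.
Qed.

(* [jtriple] is convertible to a sum, so that additivity rules would match it;
   the sealed copy [triple] avoids this. *)
HB.lock Definition triple (k : comPzRingType) (A B : lmodType k)
  (Q : A -> B -> A) (a : A) (b : B) (c : A) : A := jtriple Q a b c.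

Lemma tripleE (k : comPzRingType) (A B : lmodType k) (Q : A -> B -> A) :
  jtriple Q = triple Q.
Proof. by rewrite unlock. Qed.

Section Triple.
Variables (k : comPzRingType) (A B : lmodType k) (Q : A -> B -> A).

Lemma QD a c b : Q (a + c) b = Q a b + Q c b + triple Q a b c.
Proof. by rewrite -tripleE /jtriple /polar; zmod. Qed.

Lemma tripleC a b c : triple Q a b c = triple Q c b a.
Proof. by rewrite -tripleE /jtriple /polar addrAC [c + a]addrC. Qed.

Hypothesis Q_quad : hom_quadratic Q.

Lemma triple_linear1 b c : linear (fun a => triple Q a b c).
Proof. by rewrite -tripleE; exact: ((Q_quad.2 b).2).2. Qed.

Lemma triple_bilin a : bilin (triple Q a).
Proof.
rewrite -tripleE; split=> [b|c]; first exact: ((Q_quad.2 b).2).1.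
by move=> t u v; rewrite /jtriple /polar !Q_quad.1 !scalerBr; zmod.
Qed.

Lemma tripleDl a a' b c :
  triple Q (a + a') b c = triple Q a b c + triple Q a' b c.
Proof. exact: (linD (triple_linear1 b c)). Qed.

Lemma tripleNl a b c : triple Q (- a) b c = - triple Q a b c.
Proof. exact: (linN (triple_linear1 b c)). Qed.

Lemma QDr a b b' : Q a (b + b') = Q a b + Q a b'.
Proof. exact: (linD (Q_quad.1 a)). Qed.

Definition triple_linE :=
  (QD, QDr, tripleDl, tripleNl,
   (fun a => bilDl (triple_bilin a), fun a => bilDr (triple_bilin a)),
   (fun a => bilNl (triple_bilin a), fun a => bilNr (triple_bilin a)),
   (fun a => bil0l (triple_bilin a), fun a => bil0r (triple_bilin a))).

End Triple.

Section JordanIdentities.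
Variables (k : comPzRingType) (A B : lmodType k).
Variables (QA : A -> B -> A) (QB : B -> A -> B).
Hypotheses (QA_quad : hom_quadratic QA) (QB_quad : hom_quadratic QB).
Hypothesis QAB : jordan_identities QA QB.
Local Notation "{ a , b , c }" := (triple QA a b c)
  (at level 0, a, b, c at level 99).
Local Notation "{ a , b , c }'" := (triple QB a b c)
  (at level 0, a, b, c at level 99).

(* The full polarization of an identity that is cubic in one variable holds
   over k itself; no proper scalar extension is needed. *)
Lemma jp1_polar x w u y z :
  {x, y, {w, z, u}} + {w, y, {x, z, u}} + {u, y, {x, z, w}} =
  {w, {y, x, z}', u} + {x, {y, w, z}', u} + {x, {y, u, z}', w}.
Proof.
pose F a := {a, y, QA a z} - QA a {y, a, z}'.
have F0 a : F a = 0 by rewrite /F -!tripleE (jp1 QAB) subrr.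
apply/eqP; rewrite -subr_eq0; apply/eqP.
(* [F] is homogeneous of degree 3, so inclusion-exclusion over the subsets of {x, w, u} keeps
   exactly its part linear in each of them. *)
transitivity (F (x + w + u) - F (x + w) - F (x + u) - F (w + u)
              + F x + F w + F u); last by rewrite !F0; zmod.
rewrite /F !(triple_linE QA_quad, triple_linE QB_quad); zmod.
Qed.

Lemma jp2_polar x u y v z :
  {{x, y, u}, v, z} + {{x, v, u}, y, z} =
  {x, {y, u, v}', z} + {u, {y, x, v}', z}.
Proof.
pose G a b := {QA a b, b, z} - {a, QB b a, z}.
have G0 a b : G a b = 0 by rewrite /G -!tripleE (jp2 QAB) subrr.
apply/eqP; rewrite -subr_eq0; apply/eqP.
(* [G] is quadratic in each argument; second differences in both keep the part linear in x, u, y and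
   v. *)
transitivity (G (x + u) (y + v) - G (x + u) y - G (x + u) v
              - G x (y + v) - G u (y + v) + G x y + G x v + G u y + G u v);
  last by rewrite !G0; zmod.
rewrite /G !(triple_linE QA_quad, triple_linE QB_quad); zmod.
Qed.

(** This is [jp1_polar] minus two instances of [jp2_polar]; the terms containing {x, z, u} or {x, z,
    w} cancel. It says that D_{x,y}, paired with -D_{y,x} on the other sign, is a derivation of the
    triple product. *)
Lemma jordan_five_linear x y w z u :
  {x, y, {w, z, u}} =
  {{x, y, w}, z, u} - {w, {y, x, z}', u} + {w, z, {x, y, u}}.
Proof.
have e1 := jp1_polar x w u y z; have e2 := jp2_polar x w y z u.
have e3 := jp2_polar x u y z w.
rewrite (tripleC QA w z {x, y, u}).
rewrite (tripleC QA u y) (tripleC QA w y) in e1.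
rewrite (tripleC QA u _ w) in e3.
apply/eqP; rewrite -subr_eq0; apply/eqP.
move/eqP: e1; rewrite -subr_eq0 => /eqP e1.
move/eqP: e2; rewrite -subr_eq0 => /eqP e2.
move/eqP: e3; rewrite -subr_eq0 => /eqP e3.
transitivity (0 - 0 - 0 : A); last by zmod.
rewrite -{1}e1 -{1}e2 -e3; zmod.
Qed.

End JordanIdentities.

(** The maps over K are prescribed only on the image of [ext_in]. This suffices: the identities are
    read there and pulled back along [ext_in], which is injective for K = k. Over the zero ring all
    modules are trivial. *)
Lemma jordan_pair_identities (k : comPzRingType) (A B : lmodType k)
    (Qp : A -> B -> A) (Qm : B -> A -> B) :
  jordan_pair Qp Qm -> jordan_identities Qp Qm.
Proof.
have [k0|k1] := eqVneq (1 : k) 0.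
  have z (V : lmodType k) (u v : V) : u = v.
    by rewrite -[u]scale1r -[v]scale1r k0 !scale0r.
  by split=> *; exact: z.
case=> _ _ ext; have [K inj] := ext_in_cancel k1.
have [QKp [QKm [[_ _] Ep Em [h1 h2 h3] _]]] := ext K.
have eD (V : lmodType k) (u v : V) : ext_in K (u + v) = ext_in K u + ext_in K v.
  exact: (bilDr (pure_bilin _ _)).
have eN (V : lmodType k) (u : V) : ext_in K (- u) = - ext_in K u.
  exact: (bilNr (pure_bilin _ _)).
have Tp a b c : jtriple QKp (ext_in K a) (ext_in K b) (ext_in K c) =
    ext_in K (jtriple Qp a b c).
  by rewrite /jtriple /polar -!eD !Ep -!eN -!eD.
have Tm a b c : jtriple QKm (ext_in K a) (ext_in K b) (ext_in K c) =
    ext_in K (jtriple Qm a b c).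
  by rewrite /jtriple /polar -!eD !Em -!eN -!eD.
split=> a b c; apply: inj; rewrite -?(Tp, Tm, Ep, Em).
- by rewrite h1.
- by rewrite h2.
- by rewrite h3.
Qed.
(** * Inner derivations of a Jordan-Kantor pair *)

Lemma jordan_pair_op (k : comPzRingType) (A B : lmodType k)
    (Qp : A -> B -> A) (Qm : B -> A -> B) :
  jordan_pair Qp Qm -> jordan_pair Qm Qp.
Proof.
case=> qp qm ext; split=> // K.
by have [QKp [QKm [[? ?] ? ? ? ?]]] := ext K; exists QKm, QKp.
Qed.

(* Exchanging the two signs halves the number of identities to prove. *)
Definition op_pair (k : comPzRingType) (P : jkPair k) : jkPair k :=
  JKPair (jordan_pair_op (jk_jordan P)) (jk_m P) (jk_p P).

Section HalfLinear.
Variables (k : comPzRingType) (P : jkPair k).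

Lemma actp_bilin : bilin (@actp k P).
Proof. exact: jk_act_bilin (jk_p P). Qed.

Lemma kapp_bilin : bilin (@kapp k P).
Proof. exact: jk_kap_bilin (jk_p P). Qed.

Lemma Vp_bilin x : bilin (@Vp k P x).
Proof.
split=> [y|z]; first exact: jk_V_linear (jk_p P) x y.
exact: (jk_V_bilin (jk_p P) z).1.
Qed.

Lemma Vp_linear1 y z : linear (fun x : Mp P => Vp x y z).
Proof. exact: (jk_V_bilin (jk_p P) z).2. Qed.

Lemma VpDl (x x' : Mp P) y z : Vp (x + x') y z = Vp x y z + Vp x' y z.
Proof. exact: (linD (Vp_linear1 y z)). Qed.

Lemma VpNl (x : Mp P) y z : Vp (- x) y z = - Vp x y z.
Proof. exact: (linN (Vp_linear1 y z)). Qed.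

Lemma kappC (x z : Mp P) : kapp x z = - kapp z x.
Proof. exact: bil_altC (kapp_bilin) (jk_kap_alt (jk_p P)) _ _. Qed.

End HalfLinear.

Lemma actm_bilin (k : comPzRingType) (P : jkPair k) : bilin (@actm k P).
Proof. exact: (actp_bilin (op_pair P)). Qed.

Lemma kapm_bilin (k : comPzRingType) (P : jkPair k) : bilin (@kapm k P).
Proof. exact: (kapp_bilin (op_pair P)). Qed.

Lemma Vm_bilin (k : comPzRingType) (P : jkPair k) y : bilin (@Vm k P y).
Proof. exact: (@Vp_bilin _ (op_pair P)). Qed.

Lemma Vm_linear1 (k : comPzRingType) (P : jkPair k) x w :
  linear (fun y : Mm P => Vm y x w).
Proof. exact: (@Vp_linear1 _ (op_pair P)). Qed.

Lemma VmDl (k : comPzRingType) (P : jkPair k) (y y' : Mm P) x w :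
  Vm (y + y') x w = Vm y x w + Vm y' x w.
Proof. exact: (@VpDl _ (op_pair P)). Qed.

Lemma VmNl (k : comPzRingType) (P : jkPair k) (y : Mm P) x w :
  Vm (- y) x w = - Vm y x w.
Proof. exact: (@VpNl _ (op_pair P)). Qed.

Lemma kapmC (k : comPzRingType) (P : jkPair k) (y w : Mm P) :
  kapm y w = - kapm w y.
Proof. exact: (@kappC _ (op_pair P)). Qed.

Section ProductLinearity.
Variables (k : comPzRingType) (P : jkPair k).

Definition actE := (bilE (actp_bilin P), bilE (actm_bilin P)).
Definition kapE := (bilE (kapp_bilin P), bilE (kapm_bilin P)).
Definition VpE :=
  ((fun x => bilDl (@Vp_bilin k P x), fun x => bilDr (@Vp_bilin k P x)),
   (fun x => bilNl (@Vp_bilin k P x), fun x => bilNr (@Vp_bilin k P x)),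
   (fun x => bil0l (@Vp_bilin k P x), fun x => bil0r (@Vp_bilin k P x))).
Definition VmE :=
  ((fun x => bilDl (@Vm_bilin k P x), fun x => bilDr (@Vm_bilin k P x)),
   (fun x => bilNl (@Vm_bilin k P x), fun x => bilNr (@Vm_bilin k P x)),
   (fun x => bil0l (@Vm_bilin k P x), fun x => bil0r (@Vm_bilin k P x))).
Definition tripE := (triple_linE (jordan_quadp (jk_jordan P)),
  triple_linE (jordan_quadm (jk_jordan P))).
Definition jkE := (actE, kapE, VpE, VmE, tripE,
  (@VpDl k P, @VpNl k P, @VmDl k P, @VmNl k P)).

End ProductLinearity.

Notation Tp := (triple (@Qp _ _)).
Notation Tm := (triple (@Qm _ _)).

Lemma DpE (k : comPzRingType) (P : jkPair k) (a : Jp P) b c :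
  Dp a b c = Tp a b c.
Proof. by rewrite -tripleE. Qed.

Lemma DmE (k : comPzRingType) (P : jkPair k) (b : Jm P) a d :
  Dm b a d = Tm b a d.
Proof. by rewrite -tripleE. Qed.

(* [half_der P] collects the conditions on a derivation whose values lie in
   [Jp P] and [Mp P]; the remaining ones are those of [half_der (op_pair P)]. *)
Record half_der (k : comPzRingType) (P : jkPair k)
    (fp : Jp P -> Jp P) (fm : Jm P -> Jm P)
    (gp : Mp P -> Mp P) (gm : Mm P -> Mm P) : Prop := HalfDer {
  der_D : forall a b c,
    fp (Tp a b c) = Tp (fp a) b c + Tp a (fm b) c + Tp a b (fp c);
  der_act : forall a y, gp (actp a y) = actp (fp a) y + actp a (gm y);
  der_V : forall x y z,
    gp (Vp x y z) = Vp (gp x) y z + Vp x (gm y) z + Vp x y (gp z);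
  der_kap : forall x z, fp (kapp x z) = kapp (gp x) z + kapp x (gp z) }.

Section HalfDer.
Variables (k : comPzRingType) (P : jkPair k).

Lemma half_der0 :
  @half_der k P (fun _ => 0) (fun _ => 0) (fun _ => 0) (fun _ => 0).
Proof.
split=> *; rewrite ?jkE ?(lin0 (triple_linear1 (jordan_quadp (jk_jordan P)) _
  _)) ?(lin0 (Vp_linear1 _ _)).
all: by rewrite ?addr0.
Qed.

Lemma half_der_lin c fp fm gp gm fp' fm' gp' gm' :
  @half_der k P fp fm gp gm -> @half_der k P fp' fm' gp' gm' ->
  @half_der k P (fun a => c *: fp a + fp' a) (fun a => c *: fm a + fm' a)
    (fun a => c *: gp a + gp' a) (fun a => c *: gm a + gm' a).
Proof.
move=> h h'; split=> *.
- rewrite (der_D h) (der_D h') triple_linear1 ?(triple_bilin _ _).2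
    ?(triple_bilin _ _).1;
    try exact: (jordan_quadp (jk_jordan P)).
  by rewrite !scalerDr; zmod.
- rewrite (der_act h) (der_act h') (actp_bilin _).2 (actp_bilin _).1.
  by rewrite !scalerDr; zmod.
- rewrite (der_V h) (der_V h') Vp_linear1 (Vp_bilin _).2 (Vp_bilin _).1.
  by rewrite !scalerDr; zmod.
- rewrite (der_kap h) (der_kap h') (kapp_bilin _).2 (kapp_bilin _).1.
  by rewrite !scalerDr; zmod.
Qed.

Lemma half_derN fp fm gp gm : @half_der k P fp fm gp gm ->
  @half_der k P (fun a => - fp a) (fun a => - fm a)
    (fun a => - gp a) (fun a => - gm a).
Proof.
move=> h; have := half_der_lin (-1) h half_der0.
suff E (V : lmodType k) (f : V -> V) : (fun a => -1 *: f a + 0) = (fun a => -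
  f a).
  by rewrite !E.
by apply/funext => a; rewrite scaleN1r addr0.
Qed.

(** Not an axiom, but the M^+ component of delta(a, kappa(y, w)) = v(a ∘ y, w) - v(a ∘ w, y), hence
    needed for the last relation of uider(P). *)
Lemma act_kapm_act (a : Jp P) y w z :
  actp a (actm (kapm y w) z) = Vp (actp a y) w z - Vp (actp a w) y z.
Proof.
have e t s : actp a (Vm t z s) =
    actp (kapp (actp a t) z) s - Vp z t (actp a s).
  by rewrite (jk_act_kap_act (jk_m P)); zmod.
rewrite (jk_kap_act (jk_m P)) !jkE !e !(jk_kap_act (jk_p P)); zmod.
Qed.

Lemma half_der_delta (a : Jp P) b :
  half_der (Tp a b) (fun d => - Tm b a d)
    (fun z => actp a (actm b z)) (fun w => - actm b (actp a w)).
Proof.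
split=> [c d e|c y|x y z|x z].
- rewrite [LHS](jordan_five_linear (jordan_quadp (jk_jordan P))
    (jordan_quadm (jk_jordan P)) (jordan_pair_identities (jk_jordan P))).
  by rewrite !jkE.
- by rewrite -tripleE (jk_act_triple (jk_p P)) !jkE; zmod.
(* No single axiom applies [a ∘ (b ∘ _)] to {x, y, z}: first [b] and then [a] is moved inside, each
   at the cost of a kappa term, and [act_kapm_act] absorbs the one that is left. *)
- have e1 : actp a (actm b (Vp x y z)) =
      actp a (actm (kapm (actm b x) y) z) - actp a (Vm y x (actm b z)).
    by rewrite (jk_act_kap_act (jk_p P)) !jkE; zmod.
  have e2 : actp a (Vm y x (actm b z)) =
      Vp x (actm b (actp a y)) z - Vp (actp a y) (actm b x) z
      - Vp x y (actp a (actm b z)).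
    rewrite -(jk_kap_act_act (jk_p P)) (jk_act_kap_act (jk_m P)); zmod.
  rewrite e1 e2 act_kapm_act !jkE; zmod.
- by rewrite tripleC -tripleE [LHS](jk_kap_triple (jk_p P)).
Qed.

(** Only the triple product of J takes several axioms: the left side is expanded by [jk_act_triple],
    the right side by [jk_kap_triple] and [jk_triple_kap]. *)
Lemma half_der_vee (x : Mp P) y :
  half_der (fun c => kapp (actp c y) x) (fun d => - kapm (actm d x) y)
    (Vp x y) (fun w => - Vm y x w).
Proof.
split=> [a b c|c w|z w u|z u].
- rewrite -!tripleE (jk_act_triple (jk_p P)) !tripleE.
  rewrite (tripleC _ a b) !jkE -!tripleE.
  rewrite !(jk_kap_triple (jk_p P)) (jk_triple_kap (jk_p P)); zmod.
- by rewrite (jk_act_kap_act (jk_m P)) !jkE; zmod.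
- have := jk_V_comm (jk_p P) x y z w u => /eqP; rewrite subr_eq => /eqP ->.
  by rewrite !jkE; zmod.
- by rewrite (jk_kap_kap (jk_p P)).
Qed.

End HalfDer.

Lemma act_kapp_act (k : comPzRingType) (P : jkPair k) (b : Jm P) u x w :
  actm b (actp (kapp u x) w) = Vm (actm b u) x w - Vm (actm b x) u w.
Proof. exact: (@act_kapm_act k (op_pair P)). Qed.

Lemma opprK_fun (V : zmodType) (f : V -> V) : (fun v => - - f v) = f.
Proof. by apply/funext => v; rewrite opprK. Qed.

Lemma submod_val_lin (k : pzRingType) (V : lmodType k) (S : set V) c
    (x y : submod S) :
  submod_val (c *: x + y) = c *: submod_val x + submod_val y.
Proof. reflexivity. Qed.

Lemma fct_lin (k : pzRingType) (T : Type) (V : lmodType k) c (f g : T -> V) x :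
  (c *: f + g) x = c *: f x + g x.
Proof. reflexivity. Qed.

(* Sealed, so that rewriting does not see the sums inside [ider_delta]. *)
HB.lock Definition ider_Jp (k : comPzRingType) (P : jkPair k) (T : ider P)
  (a : Jp P) : Jp P := toJp (ider_app T (inJp a)).
HB.lock Definition ider_Jm (k : comPzRingType) (P : jkPair k) (T : ider P)
  (b : Jm P) : Jm P := toJm (ider_app T (inJm b)).
HB.lock Definition ider_Mp (k : comPzRingType) (P : jkPair k) (T : ider P)
  (x : Mp P) : Mp P := toMp (ider_app T (inMp x)).
HB.lock Definition ider_Mm (k : comPzRingType) (P : jkPair k) (T : ider P)
  (y : Mm P) : Mm P := toMm (ider_app T (inMm y)).

Section IderComponents.
Variables (k : comPzRingType) (P : jkPair k).
Implicit Types T U : ider P.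

(** Exchanging the signs turns delta(a, b) into -delta(b, a), whence the detour through
    [half_derN]. *)
Lemma half_der_delta_op (a : Jp P) b :
  @half_der k (op_pair P) (fun d => - Tm b a d) (Tp a b)
    (fun w => - actm b (actp a w)) (fun z => actp a (actm b z)).
Proof.
by have := half_derN (@half_der_delta k (op_pair P) b a); rewrite !opprK_fun.
Qed.

Lemma half_der_vee_op (x : Mp P) y :
  @half_der k (op_pair P) (fun d => - kapm (actm d x) y)
    (fun c => kapp (actp c y) x) (fun w => - Vm y x w) (Vp x y).
Proof.
by have := half_derN (@half_der_vee k (op_pair P) y x); rewrite !opprK_fun.
Qed.

Lemma ider_ind (Q : ider P -> Prop) : Q 0 ->
  (forall c T U, Q T -> Q U -> Q (c *: T + U)) ->
  (forall a b, Q (ider_delta a b)) -> (forall x y, Q (ider_vee x y)) ->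
  forall T, Q T.
Proof.
move=> Q0 QP QJ QM; apply: submod_ind => // T [] [p [q Tpq]]; subst T.
- by have := QJ p q; congr Q; exact: val_inj.
- by have := QM p q; congr Q; exact: val_inj.
Qed.

Lemma mkP_lin c b b' y y' x x' a a' :
  c *: @mkP k P b y x a + mkP b' y' x' a' =
  mkP (c *: b + b') (c *: y + y') (c *: x + x') (c *: a + a').
Proof. reflexivity. Qed.

Lemma toJp_linear : linear (@toJp k P). Proof. by []. Qed.
Lemma toJm_linear : linear (@toJm k P). Proof. by []. Qed.
Lemma toMp_linear : linear (@toMp k P). Proof. by []. Qed.
Lemma toMm_linear : linear (@toMm k P). Proof. by []. Qed.

Lemma inJp_linear : linear (@inJp k P).
Proof. by move=> c u v; rewrite mkP_lin !scaler0 !addr0. Qed.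
Lemma inJm_linear : linear (@inJm k P).
Proof. by move=> c u v; rewrite mkP_lin !scaler0 !addr0. Qed.
Lemma inMp_linear : linear (@inMp k P).
Proof. by move=> c u v; rewrite mkP_lin !scaler0 !addr0. Qed.
Lemma inMm_linear : linear (@inMm k P).
Proof. by move=> c u v; rewrite mkP_lin !scaler0 !addr0. Qed.

Lemma delta_linear (a : Jp P) b : linear (delta a b).
Proof.
move=> c p q; rewrite /delta mkP_lin toJp_linear toJm_linear toMp_linear.
rewrite toMm_linear !DpE !DmE !(actm_bilin P).1 !(actp_bilin P).1.
rewrite (actm_bilin P).1 !(triple_bilin _ _).1 ?opprD ?scalerN //.
  exact: jordan_quadp (jk_jordan P).
exact: jordan_quadm (jk_jordan P).
Qed.

Lemma vee_linear (x : Mp P) y : linear (vee x y).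
Proof.
move=> c p q; rewrite /vee mkP_lin toJp_linear toJm_linear toMp_linear.
rewrite toMm_linear !(actm_bilin P).2 !(actp_bilin P).2 (Vp_bilin _).1.
by rewrite (Vm_bilin _).1 (kapm_bilin _).2 (kapp_bilin _).2 !opprD !scalerN.
Qed.

Lemma ider_app_bilin : bilin (@ider_app k P).
Proof.
have lin1 p : linear (fun T => @ider_app k P T p).
  by move=> c T U; rewrite /ider_app submod_val_lin; exact: fct_lin.
split=> // T; elim/ider_ind: T => [c p q|t T U hT hU c p q|a b|x y].
- by rewrite !(lin0 (lin1 _)) scaler0 addr0.
- by rewrite !(lin1 _ t) hT hU !scalerDr !scalerA mulrC addrACA.
- exact: delta_linear.
- exact: vee_linear.
Qed.

Lemma bilin_comp (A B C A' : lmodType k) (f : A -> B -> C) (g : A' -> B)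
  (C' : lmodType k) (h : C -> C') :
  bilin f -> linear g -> linear h -> bilin (fun a b => h (f a (g b))).
Proof.
by move=> fb gl hl; split=> [a|b] c u v; rewrite ?gl ?fb.1 ?fb.2 hl.
Qed.

Lemma ider_Jp_bilin : bilin (@ider_Jp k P).
Proof.
by rewrite ider_Jp.unlock; exact: bilin_comp ider_app_bilin inJp_linear
  toJp_linear.
Qed.
Lemma ider_Jm_bilin : bilin (@ider_Jm k P).
Proof.
by rewrite ider_Jm.unlock; exact: bilin_comp ider_app_bilin inJm_linear
  toJm_linear.
Qed.
Lemma ider_Mp_bilin : bilin (@ider_Mp k P).
Proof.
by rewrite ider_Mp.unlock; exact: bilin_comp ider_app_bilin inMp_linear
  toMp_linear.
Qed.
Lemma ider_Mm_bilin : bilin (@ider_Mm k P).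
Proof.
by rewrite ider_Mm.unlock; exact: bilin_comp ider_app_bilin inMm_linear
  toMm_linear.
Qed.

Definition iderE := (bilE ider_Jp_bilin, bilE ider_Jm_bilin,
  bilE ider_Mp_bilin, bilE ider_Mm_bilin).

Lemma ider_appE T p : ider_app T p =
  mkP (ider_Jm T (toJm p)) (ider_Mm T (toMm p))
      (ider_Mp T (toMp p)) (ider_Jp T (toJp p)).
Proof.
elim/ider_ind: T => [|c T U hT hU|a b|x y].
- by rewrite !iderE (bil0l ider_app_bilin).
- rewrite ider_app_bilin.2 ider_Jp_bilin.2 ider_Jm_bilin.2 ider_Mp_bilin.2.
  by rewrite ider_Mm_bilin.2 -mkP_lin -hT -hU.
- by rewrite ider_Jp.unlock ider_Jm.unlock ider_Mp.unlock ider_Mm.unlock.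
- by rewrite ider_Jp.unlock ider_Jm.unlock ider_Mp.unlock ider_Mm.unlock.
Qed.

Lemma ider_ext T U :
  (forall a, ider_Jp T a = ider_Jp U a) ->
  (forall b, ider_Jm T b = ider_Jm U b) ->
  (forall x, ider_Mp T x = ider_Mp U x) ->
  (forall y, ider_Mm T y = ider_Mm U y) -> T = U.
Proof.
move=> hJp hJm hMp hMm; apply/val_inj/funext => p.
rewrite -[LHS]/(ider_app T p) -[RHS]/(ider_app U p) !ider_appE.
by rewrite hJp hJm hMp hMm.
Qed.

Lemma ider_Jp_delta (a : Jp P) (b : Jm P) (c : Jp P) :
  ider_Jp (ider_delta a b) c = Tp a b c.
Proof. by rewrite -DpE ider_Jp.unlock. Qed.
Lemma ider_Jm_delta (a : Jp P) (b d : Jm P) :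
  ider_Jm (ider_delta a b) d = - Tm b a d.
Proof. by rewrite -DmE ider_Jm.unlock. Qed.
Lemma ider_Mp_delta (a : Jp P) (b : Jm P) (z : Mp P) :
  ider_Mp (ider_delta a b) z = actp a (actm b z).
Proof. by rewrite ider_Mp.unlock. Qed.
Lemma ider_Mm_delta (a : Jp P) (b : Jm P) (w : Mm P) :
  ider_Mm (ider_delta a b) w = - actm b (actp a w).
Proof. by rewrite ider_Mm.unlock. Qed.
Lemma ider_Jp_vee (x : Mp P) (y : Mm P) (c : Jp P) :
  ider_Jp (ider_vee x y) c = kapp (actp c y) x.
Proof. by rewrite ider_Jp.unlock. Qed.
Lemma ider_Jm_vee (x : Mp P) (y : Mm P) (d : Jm P) :
  ider_Jm (ider_vee x y) d = - kapm (actm d x) y.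
Proof. by rewrite ider_Jm.unlock. Qed.
Lemma ider_Mp_vee (x z : Mp P) (y : Mm P) :
  ider_Mp (ider_vee x y) z = Vp x y z.
Proof. by rewrite ider_Mp.unlock. Qed.
Lemma ider_Mm_vee (x : Mp P) (y w : Mm P) :
  ider_Mm (ider_vee x y) w = - Vm y x w.
Proof. by rewrite ider_Mm.unlock. Qed.

Definition ider_genE := (ider_Jp_delta, ider_Jm_delta, ider_Mp_delta,
  ider_Mm_delta, ider_Jp_vee, ider_Jm_vee, ider_Mp_vee, ider_Mm_vee).

Lemma ider_der T :
  half_der (ider_Jp T) (ider_Jm T) (ider_Mp T) (ider_Mm T) /\
  @half_der k (op_pair P) (ider_Jm T) (ider_Jp T) (ider_Mm T) (ider_Mp T).
Proof.
have E0 (V : lmodType k) (f : ider P -> V -> V) : bilin f -> f 0 = (fun _ => 0).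
  by move=> fb; apply/funext => v; rewrite (bil0l fb).
have EL c T' U (V : lmodType k) (f : ider P -> V -> V) : bilin f ->
    f (c *: T' + U) = (fun v => c *: f T' v + f U v).
  by move=> fb; apply/funext => v; rewrite fb.2.
elim/ider_ind: T => [|c T U [hT hT'] [hU hU']|a b|x y].
- rewrite (E0 _ _ ider_Jp_bilin) (E0 _ _ ider_Jm_bilin).
  rewrite (E0 _ _ ider_Mp_bilin) (E0 _ _ ider_Mm_bilin).
  by split; exact: half_der0.
- rewrite (EL _ _ _ _ _ ider_Jp_bilin) (EL _ _ _ _ _ ider_Jm_bilin).
  rewrite (EL _ _ _ _ _ ider_Mp_bilin) (EL _ _ _ _ _ ider_Mm_bilin).
  by split; exact: half_der_lin.
- have -> : ider_Jp (ider_delta a b) = Tp a b.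
    by apply/funext => c; rewrite ider_Jp_delta.
  have -> : ider_Jm (ider_delta a b) = (fun d => - Tm b a d).
    by apply/funext => d; rewrite ider_Jm_delta.
  have -> : ider_Mp (ider_delta a b) = (fun z => actp a (actm b z)).
    by apply/funext => z; rewrite ider_Mp_delta.
  have -> : ider_Mm (ider_delta a b) = (fun w => - actm b (actp a w)).
    by apply/funext => w; rewrite ider_Mm_delta.
  split; [exact: half_der_delta | exact: half_der_delta_op].
- have -> : ider_Jp (ider_vee x y) = (fun c => kapp (actp c y) x).
    by apply/funext => c; rewrite ider_Jp_vee.
  have -> : ider_Jm (ider_vee x y) = (fun d => - kapm (actm d x) y).
    by apply/funext => d; rewrite ider_Jm_vee.
  have -> : ider_Mp (ider_vee x y) = Vp x y.
    by apply/funext => z; rewrite ider_Mp_vee.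
  have -> : ider_Mm (ider_vee x y) = (fun w => - Vm y x w).
    by apply/funext => w; rewrite ider_Mm_vee.
  split; [exact: half_der_vee | exact: half_der_vee_op].
Qed.

End IderComponents.
Section EqTransfer.
Variable V : zmodType.
Implicit Types a b l r : V.

(** Proves a goal from a known identity, leaving a pure abelian group identity to [zmod]; [eq_add]
    adds up several known identities first. *)
Lemma eq_transfer a b l r : a = b -> l - r = a - b -> l = r.
Proof. by move=> -> /eqP; rewrite subrr subr_eq0 => /eqP. Qed.

Lemma eq_add a b l r : a = b -> l = r -> a + l = b + r.
Proof. by move=> -> ->. Qed.

End EqTransfer.

(** * Commutators of inner derivations *)

Section IderBracket.
Variables (k : comPzRingType) (P : jkPair k).
Implicit Types T U W : ider P.

Lemma ider_Tp T a b c : ider_Jp T (Tp a b c) =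
  Tp (ider_Jp T a) b c + Tp a (ider_Jm T b) c + Tp a b (ider_Jp T c).
Proof. exact: (der_D (ider_der T).1). Qed.
Lemma ider_Tm T b a d : ider_Jm T (Tm b a d) =
  Tm (ider_Jm T b) a d + Tm b (ider_Jp T a) d + Tm b a (ider_Jm T d).
Proof. exact: (der_D (ider_der T).2). Qed.
Lemma ider_actp T a y :
  ider_Mp T (actp a y) = actp (ider_Jp T a) y + actp a (ider_Mm T y).
Proof. exact: (der_act (ider_der T).1). Qed.
Lemma ider_actm T b x :
  ider_Mm T (actm b x) = actm (ider_Jm T b) x + actm b (ider_Mp T x).
Proof. exact: (der_act (ider_der T).2). Qed.
Lemma ider_Vp T x y z : ider_Mp T (Vp x y z) =
  Vp (ider_Mp T x) y z + Vp x (ider_Mm T y) z + Vp x y (ider_Mp T z).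
Proof. exact: (der_V (ider_der T).1). Qed.
Lemma ider_Vm T y x w : ider_Mm T (Vm y x w) =
  Vm (ider_Mm T y) x w + Vm y (ider_Mp T x) w + Vm y x (ider_Mm T w).
Proof. exact: (der_V (ider_der T).2). Qed.
Lemma ider_kapp T x z :
  ider_Jp T (kapp x z) = kapp (ider_Mp T x) z + kapp x (ider_Mp T z).
Proof. exact: (der_kap (ider_der T).1). Qed.
Lemma ider_kapm T y w :
  ider_Jm T (kapm y w) = kapm (ider_Mm T y) w + kapm y (ider_Mm T w).
Proof. exact: (der_kap (ider_der T).2). Qed.

Definition ider_prodE := (ider_Tp, ider_Tm, ider_actp, ider_actm,
  ider_Vp, ider_Vm, ider_kapp, ider_kapm).

(** [ider_bracket] takes a default value outside ider(P), so an element [W] with the components of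
    the commutator must be exhibited before the bracket can be computed. *)
Record ider_comm T U W : Prop := IderComm {
  comm_Jp : forall a,
    ider_Jp W a = ider_Jp T (ider_Jp U a) - ider_Jp U (ider_Jp T a);
  comm_Jm : forall a,
    ider_Jm W a = ider_Jm T (ider_Jm U a) - ider_Jm U (ider_Jm T a);
  comm_Mp : forall a,
    ider_Mp W a = ider_Mp T (ider_Mp U a) - ider_Mp U (ider_Mp T a);
  comm_Mm : forall a,
    ider_Mm W a = ider_Mm T (ider_Mm U a) - ider_Mm U (ider_Mm T a) }.

Lemma ider_comm_uniq T U W W' : ider_comm T U W -> ider_comm T U W' -> W = W'.
Proof. by move=> [? ? ? ?] [? ? ? ?]; apply: ider_ext => ?; congruence. Qed.

(** Closure of ider(P) under commutators starts here: since [T] is a derivation, its commutator with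
    a generator is a sum of two generators. *)
Lemma ider_comm_delta T a b : ider_comm T (ider_delta a b)
  (ider_delta (ider_Jp T a) b + ider_delta a (ider_Jm T b)).
Proof.
by split=> c; rewrite ?(iderE P) !ider_genE ?(iderE P) ?ider_prodE; try
  rewrite !(jkE P); zmod.
Qed.

Lemma ider_comm_vee T x y : ider_comm T (ider_vee x y)
  (ider_vee (ider_Mp T x) y + ider_vee x (ider_Mm T y)).
Proof.
by split=> c; rewrite ?(iderE P) !ider_genE ?(iderE P) ?ider_prodE; try
  rewrite !(jkE P); zmod.
Qed.

Lemma ider_comm_lin c T U U' W W' : ider_comm T U W -> ider_comm T U' W' ->
  ider_comm T (c *: U + U') (c *: W + W').
Proof.
move=> [h1 h2 h3 h4] [h1' h2' h3' h4']; split=> v.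
- rewrite (ider_Jp_bilin P).2 h1 h1' !(ider_Jp_bilin P).2 (ider_Jp_bilin P).1.
  by rewrite scalerBr; zmod.
- rewrite (ider_Jm_bilin P).2 h2 h2' !(ider_Jm_bilin P).2 (ider_Jm_bilin P).1.
  by rewrite scalerBr; zmod.
- rewrite (ider_Mp_bilin P).2 h3 h3' !(ider_Mp_bilin P).2 (ider_Mp_bilin P).1.
  by rewrite scalerBr; zmod.
- rewrite (ider_Mm_bilin P).2 h4 h4' !(ider_Mm_bilin P).2 (ider_Mm_bilin P).1.
  by rewrite scalerBr; zmod.
Qed.

Lemma ider_comm_exists T U : exists W, ider_comm T U W.
Proof.
elim/ider_ind: U => [|c U U' [W h] [W' h']|a b|x y].
- by exists 0; split=> v; rewrite !(iderE P) subr0.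
- by exists (c *: W + W'); exact: ider_comm_lin.
- by eexists; exact: ider_comm_delta.
- by eexists; exact: ider_comm_vee.
Qed.

Lemma ider_comm_bracket T U : ider_comm T U (ider_bracket T U).
Proof.
have [W hW] := ider_comm_exists T U; suff -> : ider_bracket T U = W by [].
have E : submod_val W = commutator (submod_val T) (submod_val U).
  apply/funext => p; rewrite /commutator.
  rewrite -[submod_val W p]/(ider_app W p) -![submod_val T _]/(ider_app T _).
  rewrite -![submod_val U _]/(ider_app U _) !ider_appE.
  by rewrite (comm_Jp hW) (comm_Jm hW) (comm_Mp hW) (comm_Mm hW).
by rewrite /ider_bracket /sub_bracket -E; apply: valKd.
Qed.

Lemma ider_bracketC T U : ider_bracket T U = - ider_bracket U T.
Proof.
apply: ider_comm_uniq (ider_comm_bracket _ _) _.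
have [h1 h2 h3 h4] := ider_comm_bracket U T.
by split=> v; rewrite ?(iderE P) ?h1 ?h2 ?h3 ?h4 opprB.
Qed.

Lemma ider_bracket_delta T a b : ider_bracket T (ider_delta a b) =
  ider_delta (ider_Jp T a) b + ider_delta a (ider_Jm T b).
Proof.
exact: ider_comm_uniq (ider_comm_bracket _ _) (ider_comm_delta _ _ _).
Qed.

Lemma ider_bracket_vee T x y : ider_bracket T (ider_vee x y) =
  ider_vee (ider_Mp T x) y + ider_vee x (ider_Mm T y).
Proof. exact: ider_comm_uniq (ider_comm_bracket _ _) (ider_comm_vee _ _ _). Qed.

Lemma ider_bracket_linear T : linear (ider_bracket T).
Proof.
move=> c U V; apply: ider_comm_uniq (ider_comm_bracket _ _) _.
by apply: ider_comm_lin; exact: ider_comm_bracket.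
Qed.

Lemma ider_bracketTT T : ider_bracket T T = 0.
Proof.
apply: ider_comm_uniq (ider_comm_bracket _ _) _.
by split=> v; rewrite ?(iderE P) subrr.
Qed.

Lemma ider_delta_bilin : bilin (@ider_delta k P).
Proof.
have qp := jordan_quadp (jk_jordan P); have qm := jordan_quadm (jk_jordan P).
split=> [a|b] c u v; apply: ider_ext => w.
all: rewrite ((ider_Jp_bilin P).2, (ider_Jm_bilin P).2,
  (ider_Mp_bilin P).2, (ider_Mm_bilin P).2).
all: rewrite !ider_genE.
all: rewrite ?(triple_bilin qp _).2 ?(triple_bilin qm _).2.
all: rewrite ?(triple_linear1 qp) ?(triple_linear1 qm).
all: rewrite ?(actm_bilin P).2 ?(actp_bilin P).2 ?(actm_bilin P).1
  ?(actp_bilin P).1.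
all: by rewrite ?scalerN -?opprD.
Qed.

Lemma ider_vee_bilin : bilin (@ider_vee k P).
Proof.
split=> [x|y] c u v; apply: ider_ext => w.
all: rewrite ((ider_Jp_bilin P).2, (ider_Jm_bilin P).2,
  (ider_Mp_bilin P).2, (ider_Mm_bilin P).2).
all: rewrite !ider_genE.
all: rewrite ?(Vp_bilin _).2 ?(Vm_bilin _).2 ?Vp_linear1 ?Vm_linear1.
all: rewrite ?(actm_bilin P).1 ?(actp_bilin P).1.
all: rewrite ?(kapm_bilin P).2 ?(kapm_bilin P).1 ?(kapp_bilin P).2
  ?(kapp_bilin P).1.
all: by rewrite ?scalerN -?opprD.
Qed.

End IderBracket.
(** * The Lie algebra [uider] *)

(* The condition for a pair of bilinear maps to factor through [uider]. *)
Record balanced (k : comPzRingType) (P : jkPair k) (W : lmodType k)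
    (f : Jp P -> Jm P -> W) (g : Mp P -> Mm P -> W) : Prop := Balanced {
  bal_f : bilin f;
  bal_g : bilin g;
  bal1 : forall x y, g x (Vm y x y) = g (Vp x y x) y;
  bal2 : forall x y u w, g (Vp x y u) w + g (Vp u w x) y =
    g u (Vm y x w) + g x (Vm w u y);
  bal3 : forall a b, f a (Tm b a b) = f (Tp a b a) b;
  bal4 : forall a b c d, f (Tp a b c) d + f (Tp c d a) b =
    f c (Tm b a d) + f a (Tm b c d);
  bal5 : forall u x b, f (kapp u x) b = g x (actm b u) - g u (actm b x);
  bal6 : forall a y w, f a (kapm y w) = g (actp a y) w - g (actp a w) y }.

Section UiderLift.
Variables (k : comPzRingType) (P : jkPair k).

Section Lift.
Variables (W : lmodType k).
Variables (f : Jp P -> Jm P -> W) (g : Mp P -> Mm P -> W).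
Hypothesis fg : balanced f g.

Let pre (t : uider_pre P) : W := tlift f t.1 + tlift g t.2.

Let pre_linear : linear pre.
Proof.
move=> c s t; rewrite /pre -[(c *: s + t).1]/(c *: s.1 + t.1).
rewrite -[(c *: s + t).2]/(c *: s.2 + t.2) !(tlift_linear (bal_f fg)).
by rewrite !(tlift_linear (bal_g fg)) scalerDr addrACA.
Qed.

Let preJE a b : pre (preJ a b) = f a b.
Proof.
by rewrite /pre (tlift_pure (bal_f fg)) (lin0 (tlift_linear (bal_g fg))) addr0.
Qed.

Let preME x y : pre (preM x y) = g x y.
Proof.
by rewrite /pre (tlift_pure (bal_g fg)) (lin0 (tlift_linear (bal_f fg))) add0r.
Qed.

Let kills v : uider_rel v -> pre v = 0.
Proof.
have [h he] := lin_ext pre_linear.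
have hJ a b : h (preJ a b) = f a b by rewrite -he preJE.
have hM x y : h (preM x y) = g x y by rewrite -he preME.
rewrite he; case=> [x y|x y u w|a b|a b c d|u x b|a y w].
all: rewrite !(linearB, linearD) /= !(hJ, hM) ?DpE ?DmE.
- by apply: (eq_transfer (bal1 fg x y)); zmod.
- by apply: (eq_transfer (bal2 fg x y u w)); zmod.
- by apply: (eq_transfer (bal3 fg a b)); zmod.
- by apply: (eq_transfer (bal4 fg a b c d)); zmod.
- by apply: (eq_transfer (bal5 fg u x b)); zmod.
- by apply: (eq_transfer (bal6 fg a y w)); zmod.
Qed.

Lemma uider_lift_spec : [/\ linear (uider_lift f g),
  forall a b, uider_lift f g (diaJ a b) = f a b &
  forall x y, uider_lift f g (diaM x y) = g x y].
Proof.
have [h he] := lin_ext pre_linear.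
have hk v : uider_rel v -> h v = 0 by rewrite -he; exact: kills.
rewrite /uider_lift -/pre he; split=> [|a b|x y].
- exact: qlift_linear.
- by rewrite [LHS]qliftE // -he preJE.
- by rewrite [LHS]qliftE // -he preME.
Qed.

End Lift.

Lemma uider_ind (Q : uider P -> Prop) : Q 0 ->
  (forall c p q, Q p -> Q q -> Q (c *: p + q)) ->
  (forall a b, Q (diaJ a b)) -> (forall x y, Q (diaM x y)) -> forall p, Q p.
Proof.
move=> Q0 QP QJ QM p; rewrite -[p]qpi_repr; case: (repr _) => s t.
have -> : (s, t) = 1 *: (s, 0) + (0, t) :> uider_pre P.
  by rewrite scale1r; congr pair; rewrite /= ?addr0 ?add0r.
rewrite (qpi_linear _ 1); apply: (QP).
- elim/tensor_ind: s => [|c s s' hs hs'|a b].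
  + by rewrite [qpi _](linear0 (@qpi k _ _)).
  + rewrite (_ : (c *: s + s', 0) = c *: (s, 0) + (s', 0) :> uider_pre P).
      by rewrite qpi_linear; exact: (QP).
    by congr pair; rewrite /= scaler0 addr0.
  + exact: QJ.
- elim/tensor_ind: t => [|c t t' ht ht'|x y].
  + by rewrite [qpi _](linear0 (@qpi k _ _)).
  + rewrite (_ : (0, c *: t + t') = c *: (0, t) + (0, t') :> uider_pre P).
      by rewrite qpi_linear; exact: (QP).
    by congr pair; rewrite /= scaler0 addr0.
  + exact: QM.
Qed.

Lemma diaJ_bilin : bilin (@diaJ k P).
Proof.
split=> [a|b] c u v; rewrite /diaJ -qpi_linear; congr qpi; congr pair.
- exact: (pure_bilin _ _).1.
- by rewrite /= scaler0 addr0.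
- exact: (pure_bilin _ _).2.
- by rewrite /= scaler0 addr0.
Qed.

Lemma diaM_bilin : bilin (@diaM k P).
Proof.
split=> [a|b] c u v; rewrite /diaM -qpi_linear; congr qpi; congr pair.
- by rewrite /= scaler0 addr0.
- exact: (pure_bilin _ _).1.
- by rewrite /= scaler0 addr0.
- exact: (pure_bilin _ _).2.
Qed.

Lemma dia_balanced : balanced (@diaJ k P) (@diaM k P).
Proof.
have qpiB u v : qpi (u - v) = qpi u - qpi v :> uider P by exact: linearB.
have rel v : uider_rel v -> qpi v = 0 :> uider P.
  move=> hv; rewrite -[RHS](linear0 (@qpi k _ _)); apply/qpi_eq.
  by rewrite subr0; exact: span_gen.
have hJ a b : qpi (preJ a b) = diaJ a b by [].
have hM x y : qpi (preM x y) = diaM x y by [].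
split=> [||x y|x y u w|a b|a b c d|u x b|a y w].
- exact: diaJ_bilin.
- exact: diaM_bilin.
all: rewrite -?DpE -?DmE.
- apply: (eq_transfer (rel _ (uider_rel1 x y))).
  by rewrite qpiB subr0.
- apply: (eq_transfer (rel _ (uider_rel2 x y u w))).
  by rewrite !(qpiB, qpiD) subr0 !(hJ, hM); zmod.
- apply: (eq_transfer (rel _ (uider_rel3 a b))).
  by rewrite qpiB subr0.
- apply: (eq_transfer (rel _ (uider_rel4 a b c d))).
  by rewrite !(qpiB, qpiD) subr0 !(hJ, hM); zmod.
- apply: (eq_transfer (rel _ (uider_rel5 u x b))).
  by rewrite !(qpiB, qpiD) subr0 !(hJ, hM); zmod.
- apply: (eq_transfer (rel _ (uider_rel6 a y w))).
  by rewrite !(qpiB, qpiD) subr0 !(hJ, hM); zmod.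
Qed.

End UiderLift.
Lemma lin_swap (k : comPzRingType) (V : lmodType k) (c d : k) (u u' v v' : V) :
  d *: (c *: u + v) + (c *: u' + v') = c *: (d *: u + u') + (d *: v + v').
Proof. by rewrite !scalerDr !scalerA mulrC addrACA. Qed.

Lemma bilin_lin (k : comPzRingType) (V : lmodType k) (c : k) (u u' v v' : V) :
  c *: u + u' + (c *: v + v') = c *: (u + v) + (u' + v').
Proof. by rewrite scalerDr addrACA. Qed.

(** * Compatibility of the relations of uider(P) with derivations and with [ud] *)

Section Uider.
Variables (k : comPzRingType) (P : jkPair k).
Implicit Types (T U : ider P) (p q r : uider P).

(** Gives well-definedness of T.(p ◇ q). Applying [T] to a multilinear relation yields a sum of its
    instances; applying it to [bal1] or [bal3], which are quadratic, yields instances of [bal2] or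
    [bal4]. *)
Lemma balanced_der (W : lmodType k) (f : Jp P -> Jm P -> W)
    (g : Mp P -> Mm P -> W) T : balanced f g ->
  balanced (fun a b => f (ider_Jp T a) b + f a (ider_Jm T b))
           (fun x y => g (ider_Mp T x) y + g x (ider_Mm T y)).
Proof.
move=> fg; have fE := bilE (bal_f fg); have gE := bilE (bal_g fg).
have bilinT (A B C : lmodType k) (h : A -> B -> C) (s : A -> A) (t : B -> B) :
    bilin h -> linear s -> linear t ->
    bilin (fun a b => h (s a) b + h a (t b)).
  move=> hb sl tl; split=> [a|b] c u v.
    by rewrite tl !hb.1 scalerDr addrACA.
  by rewrite sl !hb.2 scalerDr addrACA.
split=> [||x y|x y u w|a b|a b c d|u x b|a y w].
- exact: bilinT (bal_f fg) ((ider_Jp_bilin P).1 T) ((ider_Jm_bilin P).1 T).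
- exact: bilinT (bal_g fg) ((ider_Mp_bilin P).1 T) ((ider_Mm_bilin P).1 T).
all: rewrite !ider_prodE !(fE, gE).
- apply: (eq_transfer (eq_add (esym (bal2 fg x y (ider_Mp T x) y))
    (esym (bal2 fg x y x (ider_Mm T y))))); zmod.
- apply: (eq_transfer (eq_add (eq_add (bal2 fg (ider_Mp T x) y u w)
    (bal2 fg x (ider_Mm T y) u w)) (eq_add (bal2 fg x y (ider_Mp T u) w)
    (bal2 fg x y u (ider_Mm T w))))); zmod.
- apply: (eq_transfer (eq_add (esym (bal4 fg a b (ider_Jp T a) b))
    (esym (bal4 fg a b a (ider_Jm T b))))).
  by rewrite !(tripleC _ (ider_Jp T a)) ?(tripleC _ (ider_Jm T b)); zmod.
- apply: (eq_transfer (eq_add (eq_add (bal4 fg (ider_Jp T a) b c d)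
    (bal4 fg a (ider_Jm T b) c d)) (eq_add (bal4 fg a b (ider_Jp T c) d)
    (bal4 fg a b c (ider_Jm T d))))); zmod.
- apply: (eq_transfer (eq_add (eq_add (bal5 fg (ider_Mp T u) x b)
    (bal5 fg u (ider_Mp T x) b)) (bal5 fg u x (ider_Jm T b)))); zmod.
- apply: (eq_transfer (eq_add (eq_add (bal6 fg (ider_Jp T a) y w)
    (bal6 fg a (ider_Mm T y) w)) (bal6 fg a y (ider_Mm T w)))); zmod.
Qed.

(** The first four relations are [T, T] = 0 and [T, U] + [U, T] = 0 for generators of ider(P). The
    two with kappa are compared on the four components of P. *)
Lemma ud_balanced : balanced (@ider_delta k P) (@ider_vee k P).
Proof.
have skew T U : ider_bracket T U + ider_bracket U T = 0.
  by rewrite (ider_bracketC T U) addNr.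
have dE := bilE (ider_delta_bilin P); have vE := bilE (ider_vee_bilin P).
split=> [||x y|x y u w|a b|a b c d|u x b|a y w].
- exact: ider_delta_bilin.
- exact: ider_vee_bilin.
- have := ider_bracketTT (ider_vee x y).
  rewrite ider_bracket_vee !ider_genE !(dE, vE) => h.
  by apply: (eq_transfer (esym h)); zmod.
- have := skew (ider_vee x y) (ider_vee u w).
  rewrite !ider_bracket_vee !ider_genE !(dE, vE) => h.
  by apply: (eq_transfer h); zmod.
- have := ider_bracketTT (ider_delta a b).
  rewrite ider_bracket_delta !ider_genE !(dE, vE) => h.
  by apply: (eq_transfer (esym h)); zmod.
- have := skew (ider_delta a b) (ider_delta c d).
  rewrite !ider_bracket_delta !ider_genE !(dE, vE) => h.
  apply: (eq_transfer h).
  by rewrite (tripleC _ d c b) ?(tripleC _ d a b) ; zmod.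
- apply: ider_ext => v; rewrite !(iderE P) !ider_genE.
  + rewrite -tripleE (jk_kap_triple (jk_p P)) [X in _ + X]kappC; zmod.
  + rewrite -tripleE (jk_triple_kap (jk_m P)) (kapmC (actm b x)); zmod.
  + by rewrite (jk_kap_act_act (jk_p P)).
  + by rewrite act_kapp_act; zmod.
- apply: ider_ext => v; rewrite !(iderE P) !ider_genE.
  + rewrite -tripleE (jk_triple_kap (jk_p P)) (kappC (actp a w)); zmod.
  + rewrite -tripleE (jk_kap_triple (jk_m P)) [X in - (_ + X)]kapmC; zmod.
  + by rewrite act_kapm_act.
  + by rewrite (jk_kap_act_act (jk_m P)); zmod.
Qed.

End Uider.

(* [uider] is replaced by an abstract module, which keeps unification away from
   the representatives of the quotient. *)
Record uider_model (k : comPzRingType) (P : jkPair k) (U : lmodType k)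
    (dJ : Jp P -> Jm P -> U) (dM : Mp P -> Mm P -> U)
    (inner : U -> ider P) (act : ider P -> U -> U) : Prop := UiderModel {
  model_balanced : balanced dJ dM;
  model_ind : forall Q : U -> Prop, Q 0 ->
    (forall c p q, Q p -> Q q -> Q (c *: p + q)) ->
    (forall a b, Q (dJ a b)) -> (forall x y, Q (dM x y)) -> forall p, Q p;
  inner_linear : linear inner;
  innerJ : forall a b, inner (dJ a b) = ider_delta a b;
  innerM : forall x y, inner (dM x y) = ider_vee x y;
  act_linear : forall T, linear (act T);
  actJ : forall T a b, act T (dJ a b) = dJ (ider_Jp T a) b + dJ a (ider_Jm T b);
  actM : forall T x y, act T (dM x y) = dM (ider_Mp T x) y + dM x (ider_Mm T
    y) }.

Lemma uider_modelP (k : comPzRingType) (P : jkPair k) :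
  uider_model (@diaJ k P) (@diaM k P) (@ud k P) (@uider_act k P).
Proof.
have [ud_lin udJ udM] := uider_lift_spec (ud_balanced P).
have act_spec T : [/\ linear (uider_act T),
    forall (a : Jp P) (b : Jm P), uider_act T (diaJ a b) =
      diaJ (ider_Jp T a) b + diaJ a (ider_Jm T b) &
    forall (x : Mp P) (y : Mm P), uider_act T (diaM x y) =
      diaM (ider_Mp T x) y + diaM x (ider_Mm T y)].
  rewrite ider_Jp.unlock ider_Jm.unlock ider_Mp.unlock ider_Mm.unlock.
  apply: uider_lift_spec; have := balanced_der T (dia_balanced P).
  by rewrite ider_Jp.unlock ider_Jm.unlock ider_Mp.unlock ider_Mm.unlock.
split.
- exact: dia_balanced.
- exact: uider_ind.
- exact: ud_lin.
- exact: udJ.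
- exact: udM.
- by move=> T; have [h _ _] := act_spec T; exact: h.
- by move=> T; have [_ h _] := act_spec T; exact: h.
- by move=> T; have [_ _ h] := act_spec T; exact: h.
Qed.

(** * The Lie bracket of uider(P) *)

Section UiderLie.
Variables (k : comPzRingType) (P : jkPair k) (U : lmodType k).
Variables (dJ : Jp P -> Jm P -> U) (dM : Mp P -> Mm P -> U).
Variables (inner : U -> ider P) (uact : ider P -> U -> U).
Hypothesis model : uider_model dJ dM inner uact.
Implicit Types (S T : ider P) (p q r : U).

Let diaE := (bilE (bal_f (model_balanced model)),
  bilE (bal_g (model_balanced model))).
Let lin := act_linear model.
Let uactJ := actJ model.
Let uactM := actM model.

Lemma uact_bilin : bilin uact.
Proof.
split=> // p c T S; elim/(model_ind model): p => [|d p q hp hq|a b|x y].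
- by rewrite !(lin0 (lin _)) scaler0 addr0.
- by rewrite !lin hp hq; exact: lin_swap.
- rewrite !uactJ (ider_Jp_bilin P).2 (ider_Jm_bilin P).2.
  by rewrite (bal_f (model_balanced model)).1 (bal_f (model_balanced
    model)).2; exact: bilin_lin.
- rewrite !uactM (ider_Mp_bilin P).2 (ider_Mm_bilin P).2.
  by rewrite (bal_g (model_balanced model)).1 (bal_g (model_balanced
    model)).2; exact: bilin_lin.
Qed.

(** Equivariance of [ud]. With p acting through [inner p], it turns the action property
    [uact_bracket] into the Jacobi identity of [ubr]. *)
Lemma inner_uact T p : inner (uact T p) = ider_bracket T (inner p).
Proof.
elim/(model_ind model): p => [|c p q hp hq|a b|x y].
- by rewrite (bil0r uact_bilin) !(lin0 (inner_linear model)) (lin0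
    (ider_bracket_linear T)).
- by rewrite uact_bilin.1 !(inner_linear model) hp hq ider_bracket_linear.
- by rewrite uactJ (innerJ model) ider_bracket_delta (linD (inner_linear
    model)) !(innerJ model).
- by rewrite uactM (innerM model) ider_bracket_vee (linD (inner_linear
    model)) !(innerM model).
Qed.

Lemma uact_bracket T S p : uact (ider_bracket T S) p =
  uact T (uact S p) - uact S (uact T p).
Proof.
have actD := bilDr uact_bilin; have [h1 h2 h3 h4] := ider_comm_bracket T S.
elim/(model_ind model): p => [|c p q hp hq|a b|x y].
- by rewrite !(bil0r uact_bilin) subr0.
- by rewrite !uact_bilin.1 hp hq scalerBr; zmod.
- by rewrite !(uactJ, actD) h1 h2 !diaE; zmod.
- by rewrite !(uactM, actD) h3 h4 !diaE; zmod.
Qed.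

Definition ubr p q : U := uact (inner p) q.

Lemma ubr_bilin : bilin ubr.
Proof.
split=> [p|q] c u v; rewrite /ubr; first exact: uact_bilin.1.
by rewrite (inner_linear model) uact_bilin.2.
Qed.

(** On generators of the same kind this is [bal2] or [bal4]. For a ◇ b against x ◇ y, [bal5] and
    [bal6] both produce (a ∘ y) ◇ (b ∘ x), and these terms cancel. *)
Lemma ubrC p q : ubr p q = - ubr q p.
Proof.
have bE := bilE ubr_bilin; have [bl br] := ubr_bilin.
apply/eqP; rewrite -addr_eq0; apply/eqP; have [_ _ _ b2 _ b4 b5 b6] :=
  model_balanced model.
elim/(model_ind model): p => [|c p p' hp hp'|a b|x y].
- by rewrite !bE addr0.
- by rewrite bl br addrACA -scalerDr hp hp' scaler0 addr0.
- elim/(model_ind model): q => [|c q q' hq hq'|c d|x y].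
  + by rewrite !bE addr0.
  + by rewrite bl br addrACA -scalerDr hq hq' scaler0 addr0.
  + rewrite /ubr !(innerJ model) !uactJ !ider_genE !diaE.
    apply: (eq_transfer (b4 a b c d)).
    by rewrite (tripleC _ d c b) ?(tripleC _ d a b); zmod.
  + rewrite /ubr (innerJ model) (innerM model) uactJ uactM !ider_genE !diaE.
    by rewrite b5 b6; zmod.
- elim/(model_ind model): q => [|c q q' hq hq'|a b|u w].
  + by rewrite !bE addr0.
  + by rewrite bl br addrACA -scalerDr hq hq' scaler0 addr0.
  + rewrite /ubr (innerJ model) (innerM model) uactJ uactM !ider_genE !diaE.
    by rewrite b5 b6; zmod.
  + rewrite /ubr !(innerM model) !uactM !ider_genE !diaE.
    by apply: (eq_transfer (b2 x y u w)); zmod.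
Qed.

Lemma uider_lie : is_lie ubr.
Proof.
have bE := bilE ubr_bilin; have [bl br] := ubr_bilin.
split=> [|p|p q r]; first exact: ubr_bilin.
- elim/(model_ind model): p => [|c p q hp hq|a b|x y].
  + by rewrite !bE.
  (* Alternation is not linear in p; skew-symmetry kills the cross terms. *)
  + rewrite bl !br hp hq (ubrC q p) scaler0 add0r addr0 addrC.
    by rewrite scalerN subrr.
  + rewrite /ubr (innerJ model) uactJ !ider_genE diaE.
    by rewrite (bal3 (model_balanced model)) subrr.
  + rewrite /ubr (innerM model) uactM !ider_genE diaE.
    by rewrite (bal1 (model_balanced model)) subrr.
- rewrite (ubrC r (ubr p q)).
  rewrite [ubr (ubr p q) r]/ubr [ubr p q]/ubr inner_uact uact_bracket.
  by rewrite (ubrC r p) bE /ubr; zmod.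
Qed.

End UiderLie.
(** * The Lie algebra TKK and its central extension by [uider] *)

Section Extension.
Variables (k : comPzRingType) (P : jkPair k) (U : lmodType k).
Variables (dJ : Jp P -> Jm P -> U) (dM : Mp P -> Mm P -> U).
Variables (inner : U -> ider P) (uact : ider P -> U -> U).
Hypothesis model : uider_model dJ dM inner uact.

Local Notation "[< p , q >]" := (ubr inner uact p q) (at level 0).

(** The formula of [tkk_bracket] with [U] in place of ider(P), acting on P through [inner]. *)
Definition tkk_ext_bracket (l l' : jk_mod P * U) : jk_mod P * U :=
  let: (p, X) := l in let: (q, Y) := l' in
  (ider_app (inner X) q - ider_app (inner Y) p +
     mkP (kapm (toMm p) (toMm q))
         (actm (toJm p) (toMp q) - actm (toJm q) (toMp p))
         (actp (toJp p) (toMm q) - actp (toJp q) (toMm p))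
         (kapp (toMp p) (toMp q)),
   [< X, Y >] + (dJ (toJp p) (toJm q) + dM (toMp p) (toMm q))
     - (dJ (toJp q) (toJm p) + dM (toMp q) (toMm p))).

Lemma tkk_ext_bracketE b y x a X b' y' x' a' X' :
  tkk_ext_bracket (mkP b y x a, X) (mkP b' y' x' a', X') =
  (mkP (ider_Jm (inner X) b' - ider_Jm (inner X') b + kapm y y')
       (ider_Mm (inner X) y' - ider_Mm (inner X') y
        + (actm b x' - actm b' x))
       (ider_Mp (inner X) x' - ider_Mp (inner X') x
        + (actp a y' - actp a' y))
       (ider_Jp (inner X) a' - ider_Jp (inner X') a + kapp x x'),
   [< X, X' >] + (dJ a b' + dM x y') - (dJ a' b + dM x' y)).
Proof. by rewrite /tkk_ext_bracket !ider_appE. Qed.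

Let ubrE := bilE (ubr_bilin model).
Let dE := (bilE (bal_f (model_balanced model)),
  bilE (bal_g (model_balanced model))).
Let innerD := linD (inner_linear model).
Let innerN := linN (inner_linear model).

Let inner_ubr X Y : inner [< X, Y >] = ider_bracket (inner X) (inner Y).
Proof. exact: (inner_uact model). Qed.

Let bracketE := (fun T S => comm_Jp (@ider_comm_bracket k P T S),
  fun T S => comm_Jm (@ider_comm_bracket k P T S),
  fun T S => comm_Mp (@ider_comm_bracket k P T S),
  fun T S => comm_Mm (@ider_comm_bracket k P T S)).

Let innerE := (innerD, innerN, innerJ model, innerM model, inner_ubr).

Let ubrJ X a b : [< X, dJ a b >] =
  dJ (ider_Jp (inner X) a) b + dJ a (ider_Jm (inner X) b).
Proof. exact: (actJ model). Qed.
Let ubrM X x y : [< X, dM x y >] =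
  dM (ider_Mp (inner X) x) y + dM x (ider_Mm (inner X) y).
Proof. exact: (actM model). Qed.

Let extD b y x a X b' y' x' a' X' :
  (mkP b y x a, X) + (mkP b' y' x' a', X') =
  (mkP (b + b') (y + y') (x + x') (a + a'), X + X') :> jk_mod P * U.
Proof. reflexivity. Qed.

Let ext_eq b y x a X b' y' x' a' X' : b = b' -> y = y' -> x = x' -> a = a' ->
  X = X' -> (mkP b y x a, X) = (mkP b' y' x' a', X') :> jk_mod P * U.
Proof. by move=> -> -> -> -> ->. Qed.

(** The components in P follow from the axioms and the derivation property. The component in [U] is
    the Jacobi identity of [ubr] combined with [bal5] and [bal6]. *)
Lemma tkk_ext_jacobi l1 l2 l3 :
  tkk_ext_bracket l1 (tkk_ext_bracket l2 l3)
  + tkk_ext_bracket l2 (tkk_ext_bracket l3 l1)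
  + tkk_ext_bracket l3 (tkk_ext_bracket l1 l2) = 0.
Proof.
case: l1 l2 l3 => [[[[b1 y1] x1] a1] X1] [[[[b2 y2] x2] a2] X2].
case=> [[[[b3 y3] x3] a3] X3].
rewrite -[(b1, y1, x1, a1)]/(mkP b1 y1 x1 a1) -[(b2, y2, x2, a2)]/(mkP b2 y2
  x2 a2).
rewrite -[(b3, y3, x3, a3)]/(mkP b3 y3 x3 a3) !tkk_ext_bracketE !extD.
apply: ext_eq; rewrite ?innerE ?(iderE P) ?bracketE ?ider_genE ?ider_prodE.
- rewrite !(jkE P) (tripleC _ b1 a3 b2) (tripleC _ b1 a2 b3) (tripleC _ b2 a1
    b3).
  by rewrite !(kapmC _ (actm _ _)) !(kapmC _ (ider_Mm _ _)); zmod.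
- rewrite !(jkE P) !(jk_kap_act (jk_m P)); zmod.
- rewrite !(jkE P) !(jk_kap_act (jk_p P)); zmod.
- rewrite !(jkE P) (tripleC _ a1 b3 a2) (tripleC _ a1 b2 a3) (tripleC _ a2 b1
    a3).
  by rewrite !(kappC _ (actp _ _)) !(kappC _ (ider_Mp _ _)); zmod.
- rewrite !(ubrE, ubrJ, ubrM) !dE.
  rewrite !(bal5 (model_balanced model)) !(bal6 (model_balanced model)).
  by apply: (eq_transfer (lie_jacobi (uider_lie model) X1 X2 X3)); zmod.
Qed.

Let ext_lin c b y x a X b' y' x' a' X' :
  c *: (mkP b y x a, X) + (mkP b' y' x' a', X') =
  (mkP (c *: b + b') (c *: y + y') (c *: x + x') (c *: a + a'), c *: X + X')
  :> jk_mod P * U.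
Proof. reflexivity. Qed.

Lemma tkk_ext_bracketC l l' : tkk_ext_bracket l l' = - tkk_ext_bracket l' l.
Proof.
apply/eqP; rewrite -addr_eq0; apply/eqP.
case: l l' => [[[[b1 y1] x1] a1] X1] [[[[b2 y2] x2] a2] X2].
rewrite -[(b1, y1, x1, a1)]/(mkP b1 y1 x1 a1) -[(b2, y2, x2, a2)]/(mkP b2 y2
  x2 a2).
rewrite !tkk_ext_bracketE extD; apply: ext_eq.
- by rewrite (kapmC y2); zmod.
- zmod.
- zmod.
- by rewrite (kappC x2); zmod.
- by rewrite (ubrC model X2); zmod.
Qed.

Lemma tkk_ext_bilin : bilin tkk_ext_bracket.
Proof.
have lin l : linear (tkk_ext_bracket l).
  move=> c l1 l2; case: l => [[[[b y] x] a] X].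
  case: l1 l2 => [[[[b1 y1] x1] a1] X1] [[[[b2 y2] x2] a2] X2].
  rewrite -[(b1, y1, x1, a1)]/(mkP b1 y1 x1 a1) -[(b2, y2, x2, a2)]/(mkP b2
    y2 x2 a2).
  rewrite -[(b, y, x, a)]/(mkP b y x a) ext_lin !tkk_ext_bracketE ext_lin.
  have dJb := bal_f (model_balanced model); have dMb := bal_g (model_balanced
    model).
  rewrite !(inner_linear model); apply: ext_eq.
  - rewrite (ider_Jm_bilin P).1 (ider_Jm_bilin P).2 (kapm_bilin P).1.
    by rewrite !(scalerDr, scalerN); zmod.
  - rewrite (ider_Mm_bilin P).1 (ider_Mm_bilin P).2 (actm_bilin P).1.
    by rewrite (actm_bilin P).2 !(scalerDr, scalerN); zmod.
  - rewrite (ider_Mp_bilin P).1 (ider_Mp_bilin P).2 (actp_bilin P).1.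
    by rewrite (actp_bilin P).2 !(scalerDr, scalerN); zmod.
  - rewrite (ider_Jp_bilin P).1 (ider_Jp_bilin P).2 (kapp_bilin P).1.
    by rewrite !(scalerDr, scalerN); zmod.
  - rewrite (ubr_bilin model).1 dJb.1 dJb.2 dMb.1 dMb.2.
    by rewrite !(scalerDr, scalerN, opprD); zmod.
split=> // l' c l1 l2.
by rewrite tkk_ext_bracketC lin opprD -scalerN -!tkk_ext_bracketC.
Qed.

Lemma tkk_ext_lie : is_lie tkk_ext_bracket.
Proof.
split; [exact: tkk_ext_bilin | | exact: tkk_ext_jacobi].
case=> [[[[b y] x] a] X]; rewrite -[(b, y, x, a)]/(mkP b y x a)
  tkk_ext_bracketE.
apply: ext_eq.
- by rewrite (jk_kap_alt (jk_m P)); zmod.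
- zmod.
- zmod.
- by rewrite (jk_kap_alt (jk_p P)); zmod.
- by rewrite (lie_alt (uider_lie model)); zmod.
Qed.

Definition ext_proj (l : jk_mod P * U) : tkk P := (l.1, inner l.2).

Lemma ext_proj_linear : linear ext_proj.
Proof.
by move=> c [p X] [q Y]; rewrite /ext_proj (inner_linear model).
Qed.

Lemma ext_proj_bracket l l' :
  ext_proj (tkk_ext_bracket l l') = tkk_bracket P (ext_proj l) (ext_proj l').
Proof.
case: l l' => [p X] [q Y]; rewrite /ext_proj /tkk_bracket /=.
by rewrite !innerE.
Qed.

Lemma inner_surj T : exists X, inner X = T.
Proof.
elim/ider_ind: T => [|c T S [X <-] [Y <-]|a b|x y].
- by exists 0; exact: lin0 (inner_linear model).
- by exists (c *: X + Y); exact: (inner_linear model).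
- by exists (dJ a b); exact: innerJ model _ _.
- by exists (dM x y); exact: innerM model _ _.
Qed.

Lemma ext_proj_surj l : exists m, ext_proj m = l.
Proof.
by case: l => p T; have [X <-] := inner_surj T; exists (p, X).
Qed.

(** Two lifts differ by some (0, Z) with [inner Z = 0], and such an element is central. *)
Lemma tkk_ext_bracket_ker m l l' : ext_proj l = ext_proj l' ->
  tkk_ext_bracket m l = tkk_ext_bracket m l'.
Proof.
case: l l' => [p X] [p' Y] [ <- XY].
rewrite -[(p, X)](addrNK (p, Y)) (bilDr tkk_ext_bilin).
have -> : (p, X) - (p, Y) = (0, X - Y) :> jk_mod P * U.
  by congr pair; exact: subrr.
rewrite (tkk_ext_bracketC m) -[RHS]add0r; congr (_ + _).
case: m => [q Z]; rewrite -[(0 : jk_mod P)]/(mkP 0 0 0 0).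
case: q => [[[b y] x] a]; rewrite -[(b, y, x, a)]/(mkP b y x a)
  tkk_ext_bracketE.
have -> : [< X - Y, Z >] = 0.
  by rewrite /ubr innerD innerN XY subrr (bil0l (uact_bilin model)).
have -> : inner (X - Y) = 0 by rewrite innerD innerN XY subrr.
rewrite !(iderE P) !(jkE P) !dE -[RHS]oppr0; congr (- _).
by apply: ext_eq; zmod.
Qed.

End Extension.

Section LieTransport.
Variables (k : comPzRingType) (L L' : lmodType k).
Variables (br : L -> L -> L) (br' : L' -> L' -> L') (f : L -> L').
Hypotheses (f_lin : linear f) (fM : {morph f : x y / br x y >-> br' x y}).

Lemma lie_image : (forall l, exists m, f m = l) -> is_lie br -> is_lie br'.
Proof.
move=> surj lie; split.
- split=> [l|l] c l1 l2; have [m <-] := surj l; have [m1 <-] := surj l1;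
    have [m2 <-] := surj l2.
  + by rewrite -f_lin -!fM -f_lin (lie_bilin lie).1.
  + by rewrite -f_lin -!fM -f_lin (lie_bilin lie).2.
- by move=> l; have [m <-] := surj l; rewrite -fM (lie_alt lie) (lin0 f_lin).
- move=> l1 l2 l3; have [m1 <-] := surj l1; have [m2 <-] := surj l2.
  have [m3 <-] := surj l3; rewrite -!fM -!(linD f_lin) (lie_jacobi lie).
  exact: lin0.
Qed.

Lemma lie_preimage : injective f -> is_lie br' -> is_lie br.
Proof.
move=> inj lie; split.
- by split=> l c l1 l2; apply: inj; rewrite !(fM, f_lin) ?(lie_bilin lie).1
    ?(lie_bilin lie).2.
- by move=> l; apply: inj; rewrite fM (lie_alt lie) (lin0 f_lin).
- move=> l1 l2 l3; apply: inj; rewrite !(linD f_lin) !fM (lie_jacobi lie).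
  by rewrite (lin0 f_lin).
Qed.

End LieTransport.

(** The identities need no second verification: TKK(P) is the image of the extension under
    [ext_proj]. *)
Lemma tkk_lie (k : comPzRingType) (P : jkPair k) : is_lie (tkk_bracket P).
Proof.
have model := uider_modelP P.
apply: lie_image (ext_proj_linear model) (ext_proj_bracket model)
  (ext_proj_surj model) (tkk_ext_lie model).
Qed.
(** * The universal central extension of TKK in degree 0 *)

(** These are the maps that factor linearly through uce(L), with [ang] as the universal one. *)
Record cocycle (k : comPzRingType) (L W : lmodType k) (br : L -> L -> L)
    (f : L -> L -> W) : Prop := Cocycle {
  coc_bilin : bilin f;
  coc_alt : forall x, f x x = 0;
  coc_jacobi : forall x y z,
    f x (br y z) + f y (br z x) + f z (br x y) = 0 }.

Section Uce.
Variables (k : comPzRingType) (L : lmodType k) (br : L -> L -> L).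

Lemma ang_cocycle : cocycle br (ang br).
Proof.
have qpiD (V : lmodType k) (S : set V) (u v : V) :
    qpi (u + v) = qpi u + qpi v :> qmod S by exact: linearD.
have qpi0 (V : lmodType k) (S : set V) (u : V) : S u -> qpi u = 0 :> qmod S.
  move=> Su; rewrite -[RHS](linear0 (@qpi k V S)); apply/qpi_eq.
  by rewrite subr0; exact: span_gen.
split=> [|x|x y z].
- split=> [x|y] c u v; rewrite /ang /wedge.
    by rewrite (pure_bilin _ _).1 !qpi_linear.
  by rewrite (pure_bilin _ _).2 !qpi_linear.
- rewrite /ang (_ : wedge x x = 0); first exact: linear0.
  by apply: qpi0; exists x.
- rewrite /ang -2!qpiD; apply: qpi0.
  by exists x, y, z.
Qed.

Variables (W : lmodType k) (f : L -> L -> W).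

Definition uce_lift : uce br -> W := qlift (qlift (tlift f)).

Hypothesis f_coc : cocycle br f.

Lemma uce_lift_spec : linear uce_lift /\
  forall x y, uce_lift (ang br x y) = f x y.
Proof.
have [g ge] := lin_ext (tlift_linear (coc_bilin f_coc)).
have gE x y : g (pure x y) = f x y by rewrite -ge (tlift_pure (coc_bilin
  f_coc)).
have g0 t : (exists x, t = pure x x) -> g t = 0.
  by case=> x ->; rewrite gE (coc_alt f_coc).
have [h he] := lin_ext (qlift_linear g0).
have hE x y : h (wedge x y) = f x y by rewrite -gE -he; exact: (qliftE g0).
have h0 w : (exists x y z,
    w = wedge x (br y z) + wedge y (br z x) + wedge z (br x y)) -> h w = 0.
  by case=> x [y [z ->]]; rewrite !linearD !hE (coc_jacobi f_coc).
rewrite /uce_lift ge he; split; first exact: qlift_linear.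
by move=> x y; rewrite -hE; exact: (qliftE h0).
Qed.

End Uce.

(** * Homogeneous brackets and cocycles on TKK(P) *)

Section TkkBrackets.
Variables (k : comPzRingType) (P : jkPair k).
Implicit Types T S : ider P.

Definition tkkT T : tkk P := (mkP 0 0 0 0, T).
Definition tkkJp (a : Jp P) : tkk P := tkk_in (inJp a).
Definition tkkJm (b : Jm P) : tkk P := tkk_in (inJm b).
Definition tkkMp (x : Mp P) : tkk P := tkk_in (inMp x).
Definition tkkMm (y : Mm P) : tkk P := tkk_in (inMm y).

Let bracketE b y x a T b' y' x' a' S :
  tkk_bracket P (mkP b y x a, T) (mkP b' y' x' a', S) =
  (mkP (ider_Jm T b' - ider_Jm S b + kapm y y')
       (ider_Mm T y' - ider_Mm S y + (actm b x' - actm b' x))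
       (ider_Mp T x' - ider_Mp S x + (actp a y' - actp a' y))
       (ider_Jp T a' - ider_Jp S a + kapp x x'),
   ider_bracket T S + (ider_delta a b' + ider_vee x y')
     - (ider_delta a' b + ider_vee x' y)).
Proof. by rewrite /tkk_bracket !ider_appE. Qed.

Let ext_eq b y x a T b' y' x' a' S : b = b' -> y = y' -> x = x' -> a = a' ->
  T = S -> (mkP b y x a, T) = (mkP b' y' x' a', S) :> tkk P.
Proof. by move=> -> -> -> -> ->. Qed.

Let br0 T : ider_bracket T 0 = 0.
Proof. exact: lin0 (ider_bracket_linear T). Qed.
Let br0l T : ider_bracket 0 T = 0.
Proof. by rewrite ider_bracketC br0 oppr0. Qed.
Let zeroE := (br0, br0l, bilE (ider_delta_bilin P), bilE (ider_vee_bilin P),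
  iderE P, jkE P).

Ltac tkk_solve :=
  rewrite /tkkT /tkkJp /tkkJm /tkkMp /tkkMm /tkk_in /inJp /inJm /inMp /inMm;
  rewrite bracketE; apply: ext_eq; rewrite ?zeroE; zmod.

Lemma tkk_brTJp T a : tkk_bracket P (tkkT T) (tkkJp a) = tkkJp (ider_Jp T a).
Proof. tkk_solve. Qed.
Lemma tkk_brTJm T b : tkk_bracket P (tkkT T) (tkkJm b) = tkkJm (ider_Jm T b).
Proof. tkk_solve. Qed.
Lemma tkk_brTMp T x : tkk_bracket P (tkkT T) (tkkMp x) = tkkMp (ider_Mp T x).
Proof. tkk_solve. Qed.
Lemma tkk_brTMm T y : tkk_bracket P (tkkT T) (tkkMm y) = tkkMm (ider_Mm T y).
Proof. tkk_solve. Qed.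
Lemma tkk_brJJ a b : tkk_bracket P (tkkJp a) (tkkJm b) = tkkT (ider_delta a b).
Proof. tkk_solve. Qed.
Lemma tkk_brMM x y : tkk_bracket P (tkkMp x) (tkkMm y) = tkkT (ider_vee x y).
Proof. tkk_solve. Qed.
Lemma tkk_brMpMp x u : tkk_bracket P (tkkMp x) (tkkMp u) = tkkJp (kapp x u).
Proof. tkk_solve. Qed.
Lemma tkk_brMmMm y w : tkk_bracket P (tkkMm y) (tkkMm w) = tkkJm (kapm y w).
Proof. tkk_solve. Qed.
Lemma tkk_brJpMm a y : tkk_bracket P (tkkJp a) (tkkMm y) = tkkMp (actp a y).
Proof. tkk_solve. Qed.
Lemma tkk_brJmMp b x : tkk_bracket P (tkkJm b) (tkkMp x) = tkkMm (actm b x).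
Proof. tkk_solve. Qed.

Lemma tkkT_linear : linear tkkT.
Proof.
by move=> c T S; congr pair; rewrite mkP_lin !scaler0 !addr0.
Qed.
Let tkk_in_linear : linear (@tkk_in k P).
Proof. by move=> c p q; congr pair; rewrite /= scaler0 addr0. Qed.
Lemma tkkJp_linear : linear tkkJp.
Proof. exact: lin_comp tkk_in_linear (@inJp_linear k P). Qed.
Lemma tkkJm_linear : linear tkkJm.
Proof. exact: lin_comp tkk_in_linear (@inJm_linear k P). Qed.
Lemma tkkMp_linear : linear tkkMp.
Proof. exact: lin_comp tkk_in_linear (@inMp_linear k P). Qed.
Lemma tkkMm_linear : linear tkkMm.
Proof. exact: lin_comp tkk_in_linear (@inMm_linear k P). Qed.

Section Cocycle.
Variables (W : lmodType k) (f : tkk P -> tkk P -> W).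
Hypothesis f_coc : cocycle (tkk_bracket P) f.

Let fE := bilE (coc_bilin f_coc).

Lemma cocycleC l l' : f l l' = - f l' l.
Proof. exact: bil_altC (coc_bilin f_coc) (coc_alt f_coc) _ _. Qed.

Lemma cocycle_act l m n : f l (tkk_bracket P m n) =
  f (tkk_bracket P l m) n + f m (tkk_bracket P l n).
Proof.
have lie := tkk_lie P; have brC := bil_altC (lie_bilin lie) (lie_alt lie).
apply: (eq_transfer (coc_jacobi f_coc l m n)).
by rewrite (cocycleC n) (brC n l) !fE; zmod.
Qed.

(** Parallel to [ud_balanced], with [f] on degree 0 in the role of the bracket of ider(P). The
    instance [f = ang] supplies the map psi. *)
Lemma cocycle_balanced :
  balanced (fun a b => f (tkkJp a) (tkkJm b)) (fun x y => f (tkkMp x) (tkkMm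
    y)).
Proof.
have JpN := linN tkkJp_linear; have JmN := linN tkkJm_linear.
have MpN := linN tkkMp_linear; have MmN := linN tkkMm_linear.
have skew l l' : f l l' + f l' l = 0 by rewrite (cocycleC l) addNr.
have [fl fr] := coc_bilin f_coc.
have actJ T a b : f (tkkT T) (tkkT (ider_delta a b)) =
    f (tkkJp (ider_Jp T a)) (tkkJm b) + f (tkkJp a) (tkkJm (ider_Jm T b)).
  by rewrite -tkk_brJJ cocycle_act tkk_brTJp tkk_brTJm.
have actM T x y : f (tkkT T) (tkkT (ider_vee x y)) =
    f (tkkMp (ider_Mp T x)) (tkkMm y) + f (tkkMp x) (tkkMm (ider_Mm T y)).
  by rewrite -tkk_brMM cocycle_act tkk_brTMp tkk_brTMm.
split=> [||x y|x y u w|a b|a b c d|u x b|a y w].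
- by split=> [a|b] c u v; rewrite ?tkkJp_linear ?tkkJm_linear ?fl ?fr.
- by split=> [a|b] c u v; rewrite ?tkkMp_linear ?tkkMm_linear ?fl ?fr.
- have := coc_alt f_coc (tkkT (ider_vee x y)).
  rewrite actM !ider_genE MmN !fE => h.
  by apply: (eq_transfer (esym h)); zmod.
- have := skew (tkkT (ider_vee x y)) (tkkT (ider_vee u w)).
  rewrite !actM !ider_genE !MmN !fE => h.
  by apply: (eq_transfer h); zmod.
- have := coc_alt f_coc (tkkT (ider_delta a b)).
  rewrite actJ !ider_genE JmN !fE => h.
  by apply: (eq_transfer (esym h)); zmod.
- have := skew (tkkT (ider_delta a b)) (tkkT (ider_delta c d)).
  rewrite !actJ !ider_genE !JmN !fE => h.
  apply: (eq_transfer h).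
  by rewrite (tripleC _ d c b) ?(tripleC _ d a b); zmod.
- rewrite -tkk_brMpMp cocycleC cocycle_act !tkk_brJmMp.
  by rewrite (cocycleC _ (tkkMp x)); zmod.
- rewrite -tkk_brMmMm cocycle_act !tkk_brJpMm.
  by rewrite (cocycleC (tkkMm y)); zmod.
Qed.

End Cocycle.
End TkkBrackets.

(** * Comparison of uider(P) with the degree 0 part of uce(TKK(P)) *)

Section Degree0.
Variables (k : comPzRingType) (P : jkPair k) (U E : lmodType k).
Variables (dJ : Jp P -> Jm P -> U) (dM : Mp P -> Mm P -> U).
Variables (inner : U -> ider P) (uact : ider P -> U -> U).
Hypothesis model : uider_model dJ dM inner uact.
Local Notation br := (tkk_bracket P).
Local Notation ebr := (tkk_ext_bracket dJ dM inner uact).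
Local Notation pi := (ext_proj inner).

(* Independent of the lifts chosen by [xget], which exist: see
  [ext_cocycleE]. *)
Definition ext_cocycle (l l' : tkk P) : U :=
  (ebr (xget 0 [set m | pi m = l]) (xget 0 [set m | pi m = l'])).2.

Lemma ext_cocycleE m m' : ext_cocycle (pi m) (pi m') = (ebr m m').2.
Proof.
have lift l : pi (xget 0 [set m | pi m = l]) = l.
  by case: xgetP => // h; have [n] := ext_proj_surj model l => /h.
have ebrC := tkk_ext_bracketC model.
rewrite /ext_cocycle (tkk_ext_bracket_ker model _ (lift (pi m'))) ebrC.
by rewrite (tkk_ext_bracket_ker model _ (lift (pi m))) -ebrC.
Qed.

(** Combinations and brackets of lifts are again lifts, so each condition is the [U] component of a
    Lie algebra identity in the extension. *)
Lemma ext_cocycleP : cocycle br ext_cocycle.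
Proof.
have surj := ext_proj_surj model; have [lie_b lie_a lie_j] := tkk_ext_lie model.
have piL := ext_proj_linear model; have piM := ext_proj_bracket model.
split.
- split=> l c l1 l2; have [m <-] := surj l; have [m1 <-] := surj l1;
    have [m2 <-] := surj l2; rewrite -piL !ext_cocycleE.
  + by rewrite lie_b.1.
  + by rewrite lie_b.2.
- by move=> l; have [m <-] := surj l; rewrite ext_cocycleE lie_a.
- move=> l1 l2 l3; have [m1 <-] := surj l1; have [m2 <-] := surj l2.
  have [m3 <-] := surj l3; rewrite -!piM !ext_cocycleE.
  exact: (congr1 snd (lie_j m1 m2 m3)).
Qed.

(** [E] and [f] stand for uce(TKK(P)) and [ang], [theta] for the map induced by [ext_cocycle], [u]
    for the canonical map. As with [U], the quotient construction is kept out of sight. *)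
Variables (f : tkk P -> tkk P -> E) (psi : U -> E) (theta : E -> U).
Variable (u : E -> tkk P).
Hypothesis f_coc : cocycle br f.
Hypotheses (psi_lin : linear psi) (theta_lin : linear theta) (u_lin : linear u).
Hypothesis psiJ : forall a b, psi (dJ a b) = f (tkkJp a) (tkkJm b).
Hypothesis psiM : forall x y, psi (dM x y) = f (tkkMp x) (tkkMm y).
Hypothesis thetaE : forall l l', theta (f l l') = ext_cocycle l l'.
Hypothesis uE : forall l l', u (f l l') = br l l'.

Lemma thetaK p : theta (psi p) = p.
Proof.
have dE := (bilE (bal_f (model_balanced model)),
  bilE (bal_g (model_balanced model))).
have i0 := lin0 (inner_linear model).
have piE q : (q, 0) = pi (q, 0) by rewrite /ext_proj i0.
elim/(model_ind model): p => [|c p q hp hq|a b|x y].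
- by rewrite (lin0 psi_lin) (lin0 theta_lin).
- by rewrite psi_lin theta_lin hp hq.
- rewrite psiJ thetaE /tkkJp /tkkJm /tkk_in !piE ext_cocycleE /inJp /inJm.
  by rewrite tkk_ext_bracketE (bilE (ubr_bilin model)) !dE /=; zmod.
- rewrite psiM thetaE /tkkMp /tkkMm /tkk_in !piE ext_cocycleE /inMp /inMm.
  by rewrite tkk_ext_bracketE (bilE (ubr_bilin model)) !dE /=; zmod.
Qed.

(** Under psi the canonical map becomes [ud]; this matches the degree 0 part of its kernel with
    HC(P). *)
Lemma u_psi p : u (psi p) = tkkT (inner p).
Proof.
elim/(model_ind model): p => [|c p q hp hq|a b|x y].
- by rewrite (lin0 psi_lin) (lin0 u_lin) (lin0 (inner_linear model)).
- by rewrite psi_lin u_lin hp hq (inner_linear model) (@tkkT_linear k P).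
- by rewrite psiJ uE tkk_brJJ (innerJ model).
- by rewrite psiM uE tkk_brMM (innerM model).
Qed.

Lemma psi_act T p : f (tkkT T) (tkkT (inner p)) = psi (uact T p).
Proof.
have [fl fr] := coc_bilin f_coc.
elim/(model_ind model): p => [|c p q hp hq|a b|x y].
- rewrite (lin0 (inner_linear model)) (lin0 (act_linear model T)).
  by rewrite (lin0 psi_lin) (lin0 (@tkkT_linear k P)) (bil0r (coc_bilin f_coc)).
- by rewrite (inner_linear model) (@tkkT_linear k P) fl hp hq (act_linear
    model) psi_lin.
- rewrite (innerJ model) -tkk_brJJ (cocycle_act f_coc) tkk_brTJp tkk_brTJm.
  by rewrite (actJ model) (linD psi_lin) !psiJ.
- rewrite (innerM model) -tkk_brMM (cocycle_act f_coc) tkk_brTMp tkk_brTMm.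
  by rewrite (actM model) (linD psi_lin) !psiM.
Qed.

Lemma psi_surj_gen d l l' : tkk_deg P d l -> tkk_deg P (0 - d) l' ->
  exists p, f l l' = psi p.
Proof.
have psiN := linN psi_lin; have brC := cocycleC f_coc.
case: l l' => [[[[b y] x] a] T] [[[[b' y'] x'] a'] T'].
rewrite /tkk_deg /toJm /toMm /toMp /toJp /=.
case=> hb hy hT hx ha [hb' hy' hT' hx' ha'].
have [d2|d2] := eqVneq d 2.
  rewrite d2 in hb hy hT hx hb' hy' hT' hx' ha' *.
  rewrite (hb isT) (hy isT) (hT isT) (hx isT).
  rewrite (hy' isT) (hT' isT) (hx' isT) (ha' isT).
  by exists (dJ a b'); rewrite psiJ.
have [d1|d1] := eqVneq d 1.
  rewrite d1 in hb hy hT ha hb' hy' hT' hx' ha' *.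
  rewrite (hb isT) (hy isT) (hT isT) (ha isT).
  rewrite (hb' isT) (hT' isT) (hx' isT) (ha' isT).
  by exists (dM x y'); rewrite psiM.
have [d0|d0] := eqVneq d 0.
  rewrite d0 in hb hy hx ha hb' hy' hx' ha' *.
  rewrite (hb isT) (hy isT) (hx isT) (ha isT).
  rewrite (hb' isT) (hy' isT) (hx' isT) (ha' isT).
  have [p <-] := inner_surj model T'.
  by exists (uact T p); rewrite -psi_act.
have [dm1|dm1] := eqVneq d (-1).
  rewrite dm1 in hb hT hx ha hb' hy' hT' hx' ha' *.
  rewrite (hb isT) (hx isT) (hT isT) (ha isT).
  rewrite (hb' isT) (hT' isT) (hy' isT) (ha' isT).
  by exists (- dM x' y); rewrite psiN psiM brC.
have [dm2|dm2] := eqVneq d (-2).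
  rewrite dm2 in hy hT hx ha hb' hy' hT' hx' ha' *.
  rewrite (hy isT) (hT isT) (hx isT) (ha isT).
  rewrite (hb' isT) (hy' isT) (hT' isT) (hx' isT).
  by exists (- dJ a' b); rewrite psiN psiJ brC.
(* Outside the degrees -2, ..., 2 the left factor vanishes. *)
exists 0; rewrite (hb dm2) (hy dm1) (hT d0) (hx d1) (ha d2) (lin0 psi_lin).
exact: bil0l (coc_bilin f_coc) _.
Qed.

(** The degree [0 - d] is left unreduced so that the set agrees with [uce_gen] at degree 0. *)
Lemma psi_span v : Defs.span [set X | exists d l l',
    [/\ tkk_deg P d l, tkk_deg P (0 - d) l' & X = f l l']] v <->
  exists p, v = psi p.
Proof.
split=> [|[p ->]].
  elim=> [{}v [d [l [l' [ld l'd ->]]]]||c v1 v2 _ [p1 ->] _ [p2 ->]].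
  - exact: psi_surj_gen ld l'd.
  - by exists 0; rewrite (lin0 psi_lin).
  - by exists (c *: p1 + p2); rewrite psi_lin.
elim/(model_ind model): p => [|c p q hp hq|a b|x y].
- by rewrite (lin0 psi_lin); exact: span_zero.
- by rewrite psi_lin; exact: span_lin.
- by rewrite psiJ; apply: span_gen; exists 2, (tkkJp a), (tkkJm b).
- by rewrite psiM; apply: span_gen; exists 1, (tkkMp x), (tkkMm y).
Qed.

Lemma psi_ubr p q : f (u (psi p)) (u (psi q)) = psi (ubr inner uact p q).
Proof. by rewrite !u_psi psi_act. Qed.

End Degree0.

Lemma sub_bracketE (k : comPzRingType) (V : lmodType k) (S : set V)
    (br : V -> V -> V) : span_closed S br ->
  forall u v : submod S,
  submod_val (sub_bracket br u v) = br (submod_val u) (submod_val v).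
Proof.
move=> clS u v; apply: insubdK; apply/asboolP.
by apply: clS; apply/asboolP; exact: submodP.
Qed.

Theorem corollary4p2p13 (k : comPzRingType) (P : jkPair k) (perfP : jk_perfect P) :
  span_closed (uce_gen (tkk_bracket P) (tkk_deg P) 0) (uce_bracket (tkk_bracket P)) /\
  exists phi : uce0 P -> uider P,
    [/\ is_lie_iso (uce0_bracket P) (uider_bracket P) phi,
        forall (a : Jp P) (b : Jm P), phi (uce0_J a b) = diaJ a b,
        forall (x : Mp P) (y : Mm P), phi (uce0_M x y) = diaM x y &
        set_bij [set X : uce0 P | uce0_u X = 0] (HC P) phi].
Proof.
have model := uider_modelP P; have lie := tkk_lie P.
have f_coc := ang_cocycle (tkk_bracket P).
have br_coc : cocycle (tkk_bracket P) (tkk_bracket P) by case: lie.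
have [psi_lin psiJ psiM] := uider_lift_spec (cocycle_balanced f_coc).
(* Only the values on generators matter from here on; the lift itself is forgotten. *)
move: (uider_lift _ _) psi_lin psiJ psiM => psi psi_lin psiJ psiM.
have [theta_lin thetaE] := uce_lift_spec (ext_cocycleP model).
move: (uce_lift _) theta_lin thetaE => theta theta_lin thetaE.
have [u_lin uE] : linear (@uce_u k _ (tkk_bracket P)) /\
  forall l l', uce_u (ang (tkk_bracket P) l l') = tkk_bracket P l l'.
  (* [uce_u] is convertible to the lift of the bracket, itself a cocycle. *)
  exact: uce_lift_spec br_coc.
have psiK := thetaK model psi_lin theta_lin psiJ psiM thetaE.
have span_psi := psi_span model f_coc psi_lin psiJ psiM.
have u_psi := u_psi model psi_lin u_lin psiJ psiM uE.
have psi_ubr := psi_ubr model f_coc psi_lin u_lin psiJ psiM uE.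
(* The degree 0 span is the image of psi, which is closed by [psi_ubr]. This is what lets
   [sub_bracketE] rule out the default value of [sub_bracket]. *)
have clos : span_closed (uce_gen (tkk_bracket P) (tkk_deg P) 0)
    (uce_bracket (tkk_bracket P)).
  move=> X Y /span_psi[p ->] /span_psi[q ->]; apply/span_psi.
  by exists (ubr (@ud k P) (@uider_act k P) p q); exact: psi_ubr.
split=> //; pose phi (X : uce0 P) := theta (submod_val X).
have phiK (X : uce0 P) : psi (phi X) = submod_val X.
  have /asboolP/span_psi[p Xp] := submodP X.
  by rewrite /phi Xp psiK.
have psi_sub p : psi p \in span_pred (uce_gen (tkk_bracket P) (tkk_deg P) 0).
  by apply/asboolP/span_psi; exists p.
pose phi' p : uce0 P := Submod (psi_sub p).
have phi'K p : phi (phi' p) = p by exact: psiK.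
have phi_inj : injective phi.
  by move=> X Y XY; apply: val_inj; rewrite /= -!phiK XY.
have phi_lin : linear phi.
  by move=> c X Y; rewrite /phi submod_val_lin theta_lin.
have phiM : {morph phi : X Y / uce0_bracket P X Y >-> uider_bracket P X Y}.
  move=> X Y; rewrite /phi [submod_val _](sub_bracketE clos) /uce_bracket.
  by rewrite -(phiK X) -(phiK Y) psi_ubr !psiK.
have kerE X : uce0_u X = 0 <-> ud (phi X) = 0.
  rewrite /uce0_u -phiK u_psi; split=> [/(congr1 snd) //|->].
  exact: lin0 (@tkkT_linear k P).
exists phi; split.
(* The Lie axioms in degree 0 of uce(TKK(P)) are pulled back from uider(P) along the injective
   [phi]. *)
- split=> //; first exact: lie_preimage phi_inj (uider_lie model).
  + exact: uider_lie model.
  + by exists phi' => // X; apply: phi_inj; rewrite phi'K.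
- by move=> a b; rewrite /phi /= -psiJ psiK.
- by move=> x y; rewrite /phi /= -psiM psiK.
- split=> [X /kerE //|X Y _ _ /phi_inj //|p pHC].
  by exists (phi' p) => //; apply/kerE; rewrite phi'K.
Qed.
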